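(* Let $\Omega\subset\mathbb{R}^d$ be a bounded domain with smooth boundary, let $a\in C_0^\infty(\Omega)$ be nonnegative and not identically zero, let $V\subset\Omega$ be open, and let $\varphi\in C^\infty(\mathbb{R}^d;\mathbb{R})$ satisfy the sub-ellipticity condition in $\overline V$. Let $P=P(x,D,\lambda)=D^2+i\lambda Da(x)D-\lambda^2$. Then there exist positive constants $C,\tilde K,\lambda_0$ such that for every $u\in C_0^\infty(V)$, every $\lambda\ge\lambda_0$ and every $\tau\ge\max\{\tilde K|\lambda|^{5/4},1\}$, $$\tau^3\big\|(1+\lambda^2a(x)^2)^{1/2}e^{\tau\varphi}u\big\|_{L^2(V)}^2+\tau\big\|(1+\lambda^2a(x)^2)^{1/2}e^{\tau\varphi}Du\big\|_{L^2(V)}^2\le C\,\big\|e^{\tau\varphi}Pu\big\|_{L^2(V)}^2 .$$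
   Context: Notation: $D_j=-i\partial_{x_j}$, $D=(D_1,\dots,D_d)$, $D^2=\sum_jD_j^2$, $Da(x)D=\sum_jD_ja(x)D_j$. Poisson bracket: $\{b,c\}=\sum_{j=1}^d(\partial_{\xi_j}b\,\partial_{x_j}c-\partial_{x_j}b\,\partial_{\xi_j}c)$. Sub-ellipticity: for a bounded open set $V\subset\mathbb{R}^d$, $\varphi\in C^\infty(\mathbb{R}^d;\mathbb{R})$ satisfies the sub-ellipticity condition in $\overline V$ if $|\nabla\varphi|>0$ in $\overline V$ and there is a constant $c>0$ such that for all $(x,\xi)\in\overline V\times\mathbb{R}^d$ and $\tau>0$: if $\mathbb{q}_2(x,\xi,\tau)=\mathbb{q}_1(x,\xi,\tau)=0$ then $\{\mathbb{q}_2,\mathbb{q}_1\}(x,\xi,\tau)\ge c(|\xi|^2+\tau^2)^{3/2}$, where $\mathbb{q}_2=|\xi|^2-\tau^2|\nabla\varphi(x)|^2$ and $\mathbb{q}_1=2\tau\,\xi\cdot\nabla\varphi(x)$ (the real and imaginary parts of $\sum_j(\xi_j+i\tau\partial_{x_j}\varphi)^2$). *)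

(* Defs.v *)
From HB Require Import structures.
From mathcomp Require Import all_boot all_order all_algebra.
From mathcomp Require Import complex.
From mathcomp Require Import all_classical all_reals all_analysis.

Set Implicit Arguments.
Unset Strict Implicit.
Unset Printing Implicit Defensive.

Import Order.TTheory GRing.Theory Num.Theory.
Import numFieldNormedType.Exports.

Local Open Scope classical_set_scope.
Local Open Scope ring_scope.

(* MathComp-Analysis only has Lebesgue measure on the line.  On R^n, seen as
   n.-tuple R with its product sigma-algebra, it is built by recursion:
   Dirac mass on the one-point space R^0, and the push-forward of the product
   of the measures on R and R^n along (x, t) |-> x :: t. *)
Section lebesgue_measure_tuple.
Context {R : realType}.
Local Notation mR := (measurableTypeR R).

Definition tuple_of_pair n (p : mR * n.-tuple mR) : n.+1.-tuple mR :=
  [tuple of p.1 :: p.2].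

Definition pair_of_tuple n (t : n.+1.-tuple mR) : mR * n.-tuple mR :=
  (thead t, [tuple of behead t]).

Lemma tuple_of_pairK n : cancel (@tuple_of_pair n) (@pair_of_tuple n).
Proof.
by case=> x t; congr pair; apply/val_inj.
Qed.

Lemma pair_of_tupleK n : cancel (@pair_of_tuple n) (@tuple_of_pair n).
Proof. by move=> t; rewrite [RHS]tuple_eta; apply/val_inj. Qed.

Lemma measurable_tuple_of_pair n :
  measurable_fun [set: mR * n.-tuple mR] (@tuple_of_pair n).
Proof. exact: measurable_cons. Qed.

Lemma measurable_pair_of_tuple n :
  measurable_fun [set: n.+1.-tuple mR] (@pair_of_tuple n).
Proof.
apply/measurable_fun_pair; [exact: measurable_tnth|exact: measurable_behead].
Qed.

Section step.
Variables (n : nat) (mu : {sigma_finite_measure set (n.-tuple mR) -> \bar R}).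
Let prod_mu : {measure set (mR * n.-tuple mR) -> \bar R} :=
  (@lebesgue_measure R \x mu)%E.

Definition lebesgue_step : set (n.+1.-tuple mR) -> \bar R :=
  pushforward (@lebesgue_measure R \x mu)%E (@tuple_of_pair n).

Let mpre A : measurable A -> measurable (@tuple_of_pair n @^-1` A).
Proof.
by move=> mA; rewrite -[X in measurable X]setTI; exact: measurable_tuple_of_pair.
Qed.

Let step0 : lebesgue_step set0 = 0%E.
Proof. by rewrite /lebesgue_step /pushforward preimage_set0 (measure0 prod_mu). Qed.

Let step_ge0 A : (0 <= lebesgue_step A)%E.
Proof. by apply: integral_ge0 => x _; exact: measure_ge0. Qed.

Let step_sigma_additive : semi_sigma_additive lebesgue_step.
Proof.
move=> F mF tF mUF; rewrite /lebesgue_step /pushforward preimage_bigcup.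
apply: (@measure_semi_sigma_additive _ _ _ prod_mu).
- by move=> i; exact: mpre.
- apply/trivIsetP => /= i j _ _ ij; rewrite -preimage_setI.
  by move/trivIsetP : tF => /(_ _ _ _ _ ij) ->//; rewrite preimage_set0.
- by rewrite -preimage_bigcup; exact: mpre.
Qed.

HB.instance Definition _ := isMeasure.Build _ _ _ lebesgue_step
  step0 step_ge0 step_sigma_additive.

Let step_sigma_finite : sigma_finite [set: n.+1.-tuple mR] lebesgue_step.
Proof.
have /sigma_finiteP[G [GT ndG Goo]] := sigma_finiteT (@lebesgue_measure R).
have /sigma_finiteP[F [FT ndF Foo]] := sigma_finiteT mu.
exists (fun k => @pair_of_tuple n @^-1` (G k `*` F k)).
  rewrite -preimage_bigcup (_ : \bigcup_k _ = setT) ?preimage_setT//.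
  apply/seteqP; split => // -[x t] _.
  have [i _ Gix] : (\bigcup_k G k) x by rewrite -GT.
  have [j _ Fjt] : (\bigcup_k F k) t by rewrite -FT.
  exists (maxn i j) => //; split => /=.
  - by move: x Gix; exact/subsetPset/ndG/leq_maxl.
  - by move: t Fjt; exact/subsetPset/ndF/leq_maxr.
move=> k; have [mG Gfin] := Goo k; have [mF Ffin] := Foo k; split.
  rewrite -[X in measurable X]setTI; apply: measurable_pair_of_tuple => //.
  exact: measurableX.
rewrite /lebesgue_step /pushforward -comp_preimage.
rewrite (_ : _ \o _ = id); last by apply/funext; exact: tuple_of_pairK.
rewrite preimage_id product_measure1E//.
by rewrite lte_mul_pinfty// ge0_fin_numE.
Qed.

HB.instance Definition _ := Measure_isSigmaFinite.Build _ _ _ lebesgue_step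
  step_sigma_finite.

End step.

Fixpoint lebesgue_tuple n : {sigma_finite_measure set (n.-tuple mR) -> \bar R} :=
  match n with
  | 0 => \d_([tuple] : 0.-tuple mR)
  | m.+1 => lebesgue_step (lebesgue_tuple m)
  end.

End lebesgue_measure_tuple.

Section euclidean.
Context {R : realType} {d : nat}.
Implicit Types (x y : 'rV[R]_d) (A : set 'rV[R]_d).

Definition dot x y : R := \sum_j x ord0 j * y ord0 j.

(* The library's norm on 'rV[R]_d is the sup norm. *)
Definition enorm x : R := Num.sqrt (dot x x).

Definition cenorm (w : 'rV[R[i]]_d) : R :=
  Num.sqrt (\sum_j Normc.normc (w ord0 j) ^+ 2).

Definition partial (j : 'I_d) (f : 'rV[R]_d -> R) : 'rV[R]_d -> R :=
  fun x => 'D_(delta_mx ord0 j) f x.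

Definition grad (f : 'rV[R]_d -> R) (x : 'rV[R]_d) : 'rV[R]_d :=
  \row_j partial j f x.

(* C^oo: the iterated partial derivatives of all orders exist and are
   continuous. *)
Definition smooth (f : 'rV[R]_d -> R) : Prop :=
  forall s : seq 'I_d, let g := foldr partial f s in
    continuous g /\ forall j x, derivable g x (delta_mx ord0 j).

Definition csmooth (u : 'rV[R]_d -> R[i]) : Prop :=
  smooth (fun x => complex.Re (u x)) /\ smooth (fun x => complex.Im (u x)).

(* C_0^oo(A): elements are extended by zero to the whole space. *)
Definition test_function A (f : 'rV[R]_d -> R) : Prop :=
  [/\ smooth f, compact (closure [set x | f x != 0])
    & closure [set x | f x != 0] `<=` A].

Definition ctest_function A (u : 'rV[R]_d -> R[i]) : Prop :=
  [/\ csmooth u, compact (closure [set x | u x != 0])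
    & closure [set x | u x != 0] `<=` A].

Definition bounded_domain A : Prop :=
  [/\ A !=set0, open A, connected A & bounded_set A].

(* Near each boundary point, A is the sublevel set {rho < 0} of a smooth
   function rho without critical point. *)
Definition smooth_boundary A : Prop :=
  forall p, (closure A `\` A°) p ->
  exists (U : set 'rV[R]_d) (rho : 'rV[R]_d -> R),
    [/\ open U, U p, smooth rho, forall x, U x -> grad rho x != 0
      & A `&` U = [set x | rho x < 0] `&` U].

Definition poisson (b c : 'rV[R]_d -> 'rV[R]_d -> R) (x xi : 'rV[R]_d) : R :=
  \sum_j (partial j (b x) xi * partial j (c ^~ xi) x
          - partial j (b ^~ xi) x * partial j (c x) xi).

Section symbols.
Variables (phi : 'rV[R]_d -> R) (tau : R).

Definition q2 (x xi : 'rV[R]_d) : R :=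
  enorm xi ^+ 2 - tau ^+ 2 * enorm (grad phi x) ^+ 2.

Definition q1 (x xi : 'rV[R]_d) : R := 2 * tau * dot xi (grad phi x).

End symbols.

Definition sub_elliptic (V : set 'rV[R]_d) (phi : 'rV[R]_d -> R) : Prop :=
  (forall x, closure V x -> 0 < enorm (grad phi x)) /\
  exists2 c : R, 0 < c & forall x xi tau, closure V x -> 0 < tau ->
    q2 phi tau x xi = 0 -> q1 phi tau x xi = 0 ->
    c * (enorm xi ^+ 2 + tau ^+ 2) `^ (3 / 2)
      <= poisson (q2 phi tau) (q1 phi tau) x xi.

(* D_j = -i d/dx_j, acting on the real and imaginary parts. *)
Definition Dop (j : 'I_d) (u : 'rV[R]_d -> R[i]) (x : 'rV[R]_d) : R[i] :=
  - 'i%C * (partial j (fun y => complex.Re (u y)) x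
            +i* partial j (fun y => complex.Im (u y)) x)%C.

Definition Dgrad (u : 'rV[R]_d -> R[i]) (x : 'rV[R]_d) : 'rV[R[i]]_d :=
  \row_j Dop j u x.

Definition Pop (a : 'rV[R]_d -> R) (lambda : R) (u : 'rV[R]_d -> R[i])
    (x : 'rV[R]_d) : R[i] :=
  \sum_j Dop j (Dop j u) x
  + 'i%C * lambda%:C%C * (\sum_j Dop j (fun y => (a y)%:C%C * Dop j u y) x)
  - (lambda ^+ 2)%:C%C * u x.

Definition rV_of_tuple (t : d.-tuple (measurableTypeR R)) : 'rV[R]_d :=
  \row_j tnth t j.

(* The L^2(V)-norm of a function is that of its pointwise modulus g. *)
Definition L2norm_modulus (V : set 'rV[R]_d) (g : 'rV[R]_d -> R) : \bar R :=
  'N[lebesgue_tuple d]_2%:E[EFin \o (g \_ V) \o rV_of_tuple]%E.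

Definition L2norm (V : set 'rV[R]_d) (u : 'rV[R]_d -> R[i]) : \bar R :=
  L2norm_modulus V (fun x => Normc.normc (u x)).

Definition L2norm_vec (V : set 'rV[R]_d) (w : 'rV[R]_d -> 'rV[R[i]]_d)
    : \bar R :=
  L2norm_modulus V (fun x => cenorm (w x)).

End euclidean.

(* Main.v *)
Require Import Defs.
From mathcomp Require Import all_boot all_order all_algebra.
From mathcomp Require Import complex.
From mathcomp Require Import all_classical all_reals all_analysis.
From mathcomp Require Import measurable_realfun ring lra.

Set Implicit Arguments.
Unset Strict Implicit.
Unset Printing Implicit Defensive.

Import Order.TTheory GRing.Theory Num.Theory.
Import numFieldNormedType.Exports.

Local Open Scope classical_set_scope.
Local Open Scope ring_scope.

(** With [A = 1 + i lambda a], the function [U = A u] satisfies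
    [Delta U + (lambda^2 / A) U = - P u] up to [lambda (grad a . grad u + u Delta a)].  Since
    [a >= 0] gives [|grad a|^2 <= C a], this remainder is controlled by the weighted norms
    [|A grad u|] and [|A u|] with coefficients that [tau >= K lambda^(5/4)] makes small.
    For [v = e^(tau phi) U] one runs the classical Carleman argument: the conjugated operator
    is multiplied by its first order part plus [2 tau mu v], and integration by parts leaves
    the form [phi''(z, z) + mu |z|^2] on [grad v] and
    [tau^2 (phi''(grad phi, grad phi) - mu |grad phi|^2)] on [v].  By sub-ellipticity both are
    positive, modulo [(grad phi . grad v)^2] which the multiplier controls, if [mu] is a
    slight decrease of [phi''(grad phi, grad phi) / |grad phi|^2].  The real and imaginary
    parts of [lambda^2 / A] have gradients of size [lambda^(5/2)], not [lambda^3], again by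
    [|grad a|^2 <= C a], so that their contributions are [O(tau^2 / K^2)].
    All integrations by parts are collected in one flux, a sum of divergences of compactly
    supported fields, so that the estimate is a pointwise inequality integrated once. *)

(** The principal part of [P] has the coefficient [A = 1 + i lambda a], complex and unbounded in
    [lambda]. In terms of [A u] it becomes the Laplacian, so the Carleman constants do not depend on
    [lambda]; the weight of the theorem is [|A|]. The price is the potential
    [lambda^2 / A = p - i q]. Treated as a source it would cost [lambda^4 |v|^2], which the gain
    [tau^3 |v|^2] does not cover when [tau] is of order [lambda^(5/4)]. It therefore stays in the
    conjugated operator: [p] in the symmetric part, and [q], which couples the real and imaginary
    parts with opposite signs, in the multiplier. Integration by parts then brings in the gradients
    of [p] and [q]; a term such as [tau (grad p . grad phi) |v|^2] against [tau^3 |v|^2] asks for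
    [tau^2 >= K' lambda^(5/2)], whence the exponent 5/4. Convexity is available on [closure V] only.
    Off [V] the function vanishes near each point, and with it the densities and the flux, so the
    pointwise inequality holds on the whole space. *)

Section smooth_functions.
Context {R : realType} {d : nat}.
Local Notation E := 'rV[R]_d.
Implicit Types (f g : E -> R) (x : E).

Local Notation e j := (delta_mx ord0 j : E).

(** Recursion on the order, instead of quantification over all sequences of derivatives, lets
    closure under products, exponentials and inverses be proved by induction. *)
Fixpoint Ck n f : Prop :=
  if n is m.+1 then
    [/\ continuous f, forall j x, derivable f x (e j) &
        forall j, Ck m (partial j f)]
  else continuous f.

Definition Cinf f := forall n, Ck n f.

Lemma Ck_le n f : Ck n.+1 f -> Ck n f.
Proof. by elim: n f => [|n IH] f [cf df pf] //; split=> // j; exact: IH. Qed.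

Lemma Cinf_continuous f : Cinf f -> continuous f.
Proof. by move=> /(_ 0%N). Qed.

Lemma Cinf_derivable f : Cinf f -> forall j x, derivable f x (e j).
Proof. by move=> /(_ 1%N) []. Qed.

Lemma Cinf_partial f j : Cinf f -> Cinf (partial j f).
Proof. by move=> fs n; case: (fs n.+1) => _ _ /(_ j). Qed.

Lemma smooth_Cinf f : smooth f -> Cinf f.
Proof.
move=> sf n; elim: n f sf => [|n IH] f sf; first exact: (sf [::]).1.
split; [exact: (sf [::]).1 | exact: (sf [::]).2 | move=> j].
by apply: IH => s; have := sf (rcons s j); rewrite foldr_rcons.
Qed.

Lemma partial_cst (c : R) j x : partial j (fun=> c) x = 0.
Proof. exact: derive_cst. Qed.

Lemma partialD f g j x : derivable f x (e j) -> derivable g x (e j) ->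
  partial j (fun y => f y + g y) x = partial j f x + partial j g x.
Proof. by move=> df dg; rewrite /partial -deriveD. Qed.

Lemma partialB f g j x : derivable f x (e j) -> derivable g x (e j) ->
  partial j (fun y => f y - g y) x = partial j f x - partial j g x.
Proof. by move=> df dg; rewrite /partial -deriveB. Qed.

Lemma partialN f j x : derivable f x (e j) ->
  partial j (fun y => - f y) x = - partial j f x.
Proof. by move=> df; rewrite /partial -deriveN. Qed.

Lemma partialM f g j x : derivable f x (e j) -> derivable g x (e j) ->
  partial j (fun y => f y * g y) x = partial j f x * g x + f x * partial j g x.
Proof.
move=> df dg; rewrite /partial (_ : (fun y => _) = f * g)// deriveM//.
by rewrite /GRing.scale /= addrC mulrC.
Qed.

Lemma partialZ f (c : R) j x : derivable f x (e j) ->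
  partial j (fun y => c * f y) x = c * partial j f x.
Proof.
by move=> df; rewrite partialM ?partial_cst ?mul0r ?add0r//; exact: derivable_cst.
Qed.

Lemma partialV f j x : f x != 0 -> derivable f x (e j) ->
  partial j (fun y => (f y)^-1) x = - (f x) ^- 2 * partial j f x.
Proof. by move=> f0 df; rewrite /partial deriveV. Qed.

(** A directional derivative is the derivative of the restriction to a line; this gives access to
    the chain rule and the mean value theorem in one variable. *)
Lemma slice_quotient f x v (t : R) :
  (fun h : R => h^-1 *: (f ((h%:A + t) *: v + x) - f (t *: v + x))) =
  (fun h : R => h^-1 *: (f (h *: v + (t *: v + x)) - f (t *: v + x))).
Proof. by apply/funext => h; rewrite [_%:A]mulr1 scalerDl addrA. Qed.

Lemma derivable_slice f x v (t : R) : derivable f (t *: v + x) v ->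
  derivable (fun h : R => f (h *: v + x)) t 1.
Proof. by rewrite /derivable -slice_quotient. Qed.

Lemma derive_slice f x v (t : R) :
  'D_1 (fun h : R => f (h *: v + x)) t = 'D_v f (t *: v + x).
Proof. by rewrite /derive -slice_quotient. Qed.

Lemma is_derive_expR_comp f x v : derivable f x v ->
  is_derive x v (fun y => expR (f y)) (expR (f x) * 'D_v f x).
Proof.
move=> df; pose s (h : R) := f (h *: v + x).
have x0 : 0 *: v + x = x by rewrite scale0r add0r.
have ds : is_derive (0 : R) 1 s ('D_v f x).
  apply: DeriveDef; first by apply: derivable_slice; rewrite x0.
  by rewrite derive_slice x0.
have [dg Dg] := is_derive1_comp (is_derive_expR (s 0)) ds.
apply: DeriveDef; first exact/derivable1P.
rewrite -[in LHS]x0 -derive_slice.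
by rewrite [LHS]Dg /s x0.
Qed.

Lemma derivable_expR_comp f x v : derivable f x v ->
  derivable (fun y => expR (f y)) x v.
Proof. by case/is_derive_expR_comp. Qed.

Lemma derive_expR_comp f x v : derivable f x v ->
  'D_v (fun y => expR (f y)) x = expR (f x) * 'D_v f x.
Proof. by case/is_derive_expR_comp. Qed.

Lemma continuousM_fun f g : continuous f -> continuous g ->
  continuous (fun y => f y * g y).
Proof. by move=> cf cg x; apply: continuousM; [exact: cf|exact: cg]. Qed.

Lemma continuousD_fun f g : continuous f -> continuous g ->
  continuous (fun y => f y + g y).
Proof. by move=> cf cg x; apply: continuousD; [exact: cf|exact: cg]. Qed.

Lemma CkD n f g : Ck n f -> Ck n g -> Ck n (fun y => f y + g y).
Proof.
elim: n f g => [|n IH] f g; first exact: continuousD_fun.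
move=> [cf df pf] [cg dg pg]; split; first exact: continuousD_fun.
  by move=> j x; exact: derivableD.
move=> j; rewrite (_ : partial j _ = fun y => partial j f y + partial j g y).
  exact: IH (pf j) (pg j).
by apply/funext => x; rewrite partialD.
Qed.

Lemma CkM n f g : Ck n f -> Ck n g -> Ck n (fun y => f y * g y).
Proof.
elim: n f g => [|n IH] f g; first exact: continuousM_fun.
move=> Cf Cg; case: (Cf) => cf df pf; case: (Cg) => cg dg pg.
split; first exact: continuousM_fun.
  by move=> j x; exact: derivableM.
move=> j; rewrite (_ : partial j _ =
  fun y => partial j f y * g y + f y * partial j g y).
  exact: CkD (IH _ _ (pf j) (Ck_le Cg)) (IH _ _ (Ck_le Cf) (pg j)).
by apply/funext => x; rewrite partialM.
Qed.

Lemma Ck_cst n (c : R) : Ck n (fun=> c).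
Proof.
elim: n c => [|n IH] c; first by move=> x; exact: cst_continuous.
split; [by move=> x; exact: cst_continuous|by move=> j x; exact: derivable_cst|].
by move=> j; rewrite (_ : partial j _ = fun=> 0)//; apply/funext => x; rewrite partial_cst.
Qed.

Lemma Ck_expR n f : Ck n f -> Ck n (fun y => expR (f y)).
Proof.
elim: n f => [|n IH] f.
  by move=> cf x; apply: (@continuous_comp _ _ _ f expR); [exact: cf|exact: continuous_expR].
move=> Cf; case: (Cf) => cf df pf; split.
- by move=> x; apply: (@continuous_comp _ _ _ f expR); [exact: cf|exact: continuous_expR].
- by move=> j x; exact: derivable_expR_comp.
- move=> j; rewrite (_ : partial j _ = fun y => expR (f y) * partial j f y).
    exact: CkM (IH _ (Ck_le Cf)) (pf j).
  by apply/funext => x; rewrite /partial derive_expR_comp.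
Qed.

Lemma Ck_inv n f : (forall x, f x != 0) -> Ck n f -> Ck n (fun y => (f y)^-1).
Proof.
move=> f0; elim: n => [|n IH].
  by move=> cf x; apply: continuousV => //; exact: cf.
move=> Cf; case: (Cf) => cf df pf; split.
- by move=> x; apply: continuousV => //; exact: cf.
- by move=> j x; exact: derivableV.
- move=> j; rewrite (_ : partial j _ =
    fun y => -1 * ((f y)^-1 * (f y)^-1 * partial j f y)).
    have If := IH (Ck_le Cf).
    exact: CkM (Ck_cst _ _) (CkM (CkM If If) (pf j)).
  by apply/funext => x; rewrite partialV// mulN1r mulNr -expr2 exprVn.
Qed.

Lemma Cinf_cst (c : R) : Cinf (fun=> c).
Proof. by move=> n; exact: Ck_cst. Qed.

Lemma CinfD f g : Cinf f -> Cinf g -> Cinf (fun y => f y + g y).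
Proof. by move=> Cf Cg n; exact: CkD. Qed.

Lemma CinfM f g : Cinf f -> Cinf g -> Cinf (fun y => f y * g y).
Proof. by move=> Cf Cg n; exact: CkM. Qed.

Lemma CinfN f : Cinf f -> Cinf (fun y => - f y).
Proof.
move=> Cf; rewrite (_ : (fun y => _) = fun y => -1 * f y).
  by apply: CinfM => //; exact: Cinf_cst.
by apply/funext => y; rewrite mulN1r.
Qed.

Lemma CinfB f g : Cinf f -> Cinf g -> Cinf (fun y => f y - g y).
Proof. by move=> Cf Cg; apply: CinfD => //; exact: CinfN. Qed.

Lemma CinfX f n : Cinf f -> Cinf (fun y => f y ^+ n).
Proof.
move=> Cf; elim: n => [|n IH].
  by rewrite (_ : (fun y => _) = fun=> 1); [exact: Cinf_cst|apply/funext].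
rewrite (_ : (fun y => _) = fun y => f y * f y ^+ n); first exact: CinfM.
by apply/funext => y; rewrite exprS.
Qed.

Lemma Cinf_expR f : Cinf f -> Cinf (fun y => expR (f y)).
Proof. by move=> Cf n; exact: Ck_expR. Qed.

Lemma Cinf_inv f : (forall x, f x != 0) -> Cinf f -> Cinf (fun y => (f y)^-1).
Proof. by move=> f0 Cf n; exact: Ck_inv. Qed.

Lemma Cinf_sum (I : Type) (r : seq I) (F : I -> E -> R) :
  (forall i, Cinf (F i)) -> Cinf (fun y => \sum_(i <- r) F i y).
Proof.
move=> CF; elim: r => [|i r IH].
  by under eq_fun do rewrite big_nil; exact: Cinf_cst.
by under eq_fun do rewrite big_cons; exact: CinfD.
Qed.

Lemma partial_sum (I : Type) (r : seq I) (F : I -> E -> R) j x :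
  (forall i, Cinf (F i)) ->
  partial j (fun y => \sum_(i <- r) F i y) x = \sum_(i <- r) partial j (F i) x.
Proof.
move=> CF; elim: r => [|i r IH].
  by under eq_fun do rewrite big_nil; rewrite partial_cst big_nil.
under eq_fun do rewrite big_cons.
rewrite partialD ?big_cons ?IH//; first exact: Cinf_derivable.
exact/Cinf_derivable/Cinf_sum.
Qed.

End smooth_functions.

(** * Symmetry of second derivatives *)

Section schwarz.
Context {R : realType} {d : nat}.
Local Notation E := 'rV[R]_d.
Implicit Types (f g : E -> R) (x : E).

Local Notation e j := (delta_mx ord0 j : E).

Lemma MVT_derivable (g : R -> R) (h : R) : (forall s, derivable g s 1) ->
  0 < h -> exists2 s, 0 < s < h & g h - g 0 = 'D_1 g s * h.
Proof.
move=> dg h0.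
have [|s sh] := MVT h0 (fun s _ => derivableP (dg s)).
  by apply: derivable_within_continuous => s _; exact: dg.
by rewrite subr0 => Eg; exists s => //; move: sh; rewrite in_itv.
Qed.

(** The mean value theorem is applied twice: along [e i] to the increment of [f] in direction [e j],
    then along [e j] to [partial i f]. *)
Lemma second_difference f i j x (h : R) : Cinf f -> 0 < h ->
  exists s t, [/\ 0 < s < h, 0 < t < h &
   f (h *: e i + (h *: e j + x)) - f (h *: e i + x) - (f (h *: e j + x) - f x)
   = partial j (partial i f) (t *: e j + (s *: e i + x)) * h ^+ 2].
Proof.
move=> Cf h0.
have df k y (s : R) : derivable (fun t : R => f (t *: e k + y)) s 1.
  by apply: derivable_slice; exact: Cinf_derivable.
have [|s sh] := @MVT_derivable
    (fun s => f (s *: e i + (h *: e j + x)) - f (s *: e i + x)) h _ h0.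
  by move=> s; apply: derivableB; exact: df.
rewrite deriveB// !derive_slice !scale0r !add0r => ->.
have [|t th] := @MVT_derivable
    (fun t => partial i f (t *: e j + (s *: e i + x))) h _ h0.
  by move=> t; apply: derivable_slice; exact/Cinf_derivable/Cinf_partial.
rewrite derive_slice scale0r add0r => Et; exists s, t; split => //.
by rewrite expr2 mulrA -[X in X * h]Et /partial addrCA.
Qed.

(** The second difference is symmetric in [i] and [j], so the two mixed derivatives share a value at
    points [z] and [y] as close to [x] as desired; continuity of both concludes. *)
Lemma schwarz f i j x : Cinf f ->
  partial i (partial j f) x = partial j (partial i f) x.
Proof.
move=> Cf; pose A := partial i (partial j f); pose B := partial j (partial i f).
rewrite -[LHS]/(A x) -[RHS]/(B x).
have cA : continuous A := Cinf_continuous (Cinf_partial i (Cinf_partial j Cf)).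
have cB : continuous B := Cinf_continuous (Cinf_partial j (Cinf_partial i Cf)).
apply/eqP; rewrite -subr_eq0 -normr_le0; apply/ler_addgt0Pr => r r0.
rewrite add0r.
have r20 : 0 < r / 2 by rewrite divr_gt0.
have /nbhs_ballP[/= p p0 pA] : \forall y \near x, `|A x - A y| < r / 2.
  by have /cvgrPdist_lt/(_ _ r20) := cA x.
have /nbhs_ballP[/= q q0 qB] : \forall y \near x, `|B x - B y| < r / 2.
  by have /cvgrPdist_lt/(_ _ r20) := cB x.
pose N := `|e i| + `|e j| + 1.
have N0 : 0 < N by rewrite ltr_wpDl// addr_ge0.
pose h := Num.min p q / N.
have h0 : 0 < h by rewrite divr_gt0// lt_min; apply/andP.
have near k l s t : `|e k| + `|e l| + 1 = N -> 0 < s < h -> 0 < t < h ->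
    `|x - (t *: e l + (s *: e k + x))| < Num.min p q.
  move=> Nkl /andP[s0 sh] /andP[t0 th].
  rewrite addrA opprD addrCA subrr addr0 normrN.
  rewrite (le_lt_trans (ler_normD _ _))// !normrZ !gtr0_norm//.
  have -> : Num.min p q = h * N by rewrite /h divfK// gt_eqF.
  rewrite -Nkl !mulrDr mulr1.
  have := ler_wpM2r (normr_ge0 (e k)) (ltW sh).
  have := ler_wpM2r (normr_ge0 (e l)) (ltW th).
  lra.
have [s [t [hs ht E1]]] := second_difference i j x Cf h0.
have [s' [t' [hs' ht' E2]]] := second_difference j i x Cf h0.
set y := t *: _ + _ in E1; set z := t' *: _ + _ in E2.
have AB : A z = B y.
  apply: (@mulIf _ (h ^+ 2)); first by rewrite expf_neq0// gt_eqF.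
  rewrite -[LHS]E2 -[RHS]E1 [h *: e i + (_ + x)]addrCA; ring.
have By : `|B x - B y| < r / 2.
  apply: qB; rewrite -ball_normE.
  apply: lt_le_trans (near i j s t erefl hs ht) _.
  by rewrite ge_min lexx orbT.
have Az : `|A x - A z| < r / 2.
  apply: pA; rewrite -ball_normE.
  have Nji : `|e j| + `|e i| + 1 = N by rewrite /N [`|e j| + _]addrC.
  apply: lt_le_trans (near j i s' t' Nji hs' ht') _.
  by rewrite ge_min lexx.
move: (A x) (A z) (B x) (B y) AB By Az => a1 a2 b1 b2 -> ltb lta.
rewrite (_ : a1 - b1 = (a1 - b2) - (b1 - b2)); last by ring.
by rewrite (le_trans (ler_normB _ _))// [leRHS]splitr lerD// ltW.
Qed.

End schwarz.

(** * Measurability of continuous functions for the product sigma-algebra *)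

Section continuous_measurable.
Context {R : realType} {d : nat}.
Local Notation E := 'rV[R]_d.
Local Notation T := (d.-tuple (measurableTypeR R)).
Implicit Types (f g : E -> R) (x : E).

(** The sigma-algebra on tuples is a product one, not defined from the topology. A continuous
    function is the pointwise limit of its values at the corners of cubes of side [1 / (m + 1)];
    each approximation is constant on countably many measurable cubes. *)
Let grid (m : nat) (t : T) : 'rV[int]_d := \row_i Num.floor (m.+1%:R * tnth t i).

Let of_grid (m : nat) (k : 'rV[int]_d) : E := \row_i ((k ord0 i)%:~R / m.+1%:R).

Let measurable_grid_fiber m (k : 'rV[int]_d) : measurable [set t | grid m t = k].
Proof.
rewrite (_ : [set t | _] = \bigcap_(i in [set: 'I_d])
    ((fun t : T => tnth t i) @^-1`
     `[(k ord0 i)%:~R / m.+1%:R, (k ord0 i + 1)%:~R / m.+1%:R[)).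
  apply: fin_bigcap_measurable => // i _; rewrite -[X in measurable X]setTI.
  exact: measurable_tnth.
have itvE (y : R) (z : int) : (y \in `[z%:~R / m.+1%:R, (z + 1)%:~R / m.+1%:R[) =
    (z%:~R <= m.+1%:R * y < (z + 1)%:~R).
  by rewrite in_itv /= ler_pdivrMr// ltr_pdivlMr// [y * _]mulrC.
apply/seteqP; split=> t /=.
  move=> <- i _ /=; rewrite itvE /grid mxE; exact: floor_itv.
move=> H; apply/rowP => i; rewrite mxE; apply: floor_def.
by have := H i Logic.I; rewrite /= itvE.
Qed.

Let measurable_of_grid f m :
  measurable_fun [set: T] (fun t => f (of_grid m (grid m t)) : measurableTypeR R).
Proof.
move=> _ B mB; rewrite setTI.
rewrite (_ : _ @^-1` B = \bigcup_n
   (if unpickle n is Some k then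
      if pselect (B (f (of_grid m k))) then [set t | grid m t = k] else set0
    else set0)).
  apply: bigcupT_measurable => n; case: unpickle => [k|]; last exact: measurable0.
  by case: pselect => ?; [exact: measurable_grid_fiber|exact: measurable0].
apply/seteqP; split=> t /=.
  by move=> Bt; exists (pickle (grid m t)) => //; rewrite pickleK; case: pselect.
by case=> n _; case: unpickle => // k; case: pselect => //= Bk ->.
Qed.

Lemma cvg_of_grid (t : T) : of_grid m (grid m t) @[m --> \oo] --> rV_of_tuple t.
Proof.
apply/cvg_ballP => r r0; near=> m; split=> // i j.
rewrite /rV_of_tuple /of_grid /grid !mxE -ball_normE /ball_ /=.
have := floor_itv (m.+1%:R * tnth t j).
set z := Num.floor _ => /andP[h1]; rewrite intrD => h2.
have m0 : (0 : R) < m.+1%:R by [].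
have : m.+1%:R^-1 < r by near: m; exact: near_infty_natSinv_lt (PosNum r0).
rewrite (_ : tnth t j - _ = (m.+1%:R * tnth t j - z%:~R) / m.+1%:R); last first.
  by rewrite mulrBl mulrAC divff ?mul1r// lt0r_neq0.
rewrite normrM [X in _ * X]gtr0_norm ?invr_gt0// => hr.
rewrite (le_lt_trans _ hr)// ger_pMl ?invr_gt0//.
rewrite ler_norml; apply/andP; split; lra.
Unshelve. all: by end_near. Qed.

Lemma measurable_continuous f : continuous f ->
  measurable_fun [set: T] (fun t => f (rV_of_tuple t) : measurableTypeR R).
Proof.
move=> cf; apply: (@measurable_fun_cvg _ _ _ _ (fun m t => f (of_grid m (grid m t)))).
  exact: measurable_of_grid.
move=> t _; apply: (cvg_comp _ _ (@cvg_of_grid t)); exact: cf.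
Qed.

End continuous_measurable.

(** * Integrability of compactly supported continuous functions *)

Section compactly_supported.
Context {R : realType}.

Definition vanishing {d} (M : R) (f : 'rV[R]_d -> R) : Prop :=
  forall x, M <= `|x| -> f x = 0.

Lemma coord_le_norm {d} (x : 'rV[R]_d) i : `|x ord0 i| <= `|x|.
Proof.
rewrite [X in _ <= X](_ : _ = mx_norm x)// mx_normrE.
exact: (@le_bigmax_cond _ _ _ _ (ord0, i) predT (fun ij => `|x ij.1 ij.2|)).
Qed.

Definition box (M : R) n : set (n.-tuple (measurableTypeR R)) :=
  [set t | forall i, tnth t i \in `[- M, M]].

Arguments box : clear implicits.

Lemma measurable_box M n : measurable (box M n).
Proof.
rewrite (_ : box M n = \bigcap_(i in [set: 'I_n])
    ((fun t : n.-tuple (measurableTypeR R) => tnth t i) @^-1` `[- M, M])).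
  apply: fin_bigcap_measurable => // i _; rewrite -[X in measurable X]setTI.
  exact: measurable_tnth.
by apply/seteqP; split=> t /= H i; [move=> _; exact: H|exact: H].
Qed.

Lemma lebesgue_tuple_box M n : (lebesgue_tuple n (box M n) < +oo)%E.
Proof.
elim: n => [|n IH] /=; first by rewrite diracE; case: (_ \in _); rewrite ltry.
rewrite /lebesgue_step /pushforward.
rewrite (_ : _ @^-1` _ = `[- M, M]%classic `*` box M n).
  rewrite product_measure1E//; last exact: measurable_box.
  apply: lte_mul_pinfty => //.
  by have := lebesgue_measure_itv `[- M, M]; rewrite /= => ->; case: ifP.
apply/seteqP; split=> -[x t] /=.
  move=> H; split; first by have := H ord0; rewrite tnth0.
  by move=> i; have := H (lift ord0 i); rewrite tnthS.
move=> [Hx Ht] i; have [->|] := eqVneq i ord0; first by rewrite tnth0.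
by rewrite eq_sym => /unlift_some[k -> _]; rewrite tnthS; exact: Ht.
Qed.

Lemma continuous_bounded {d} (f : 'rV[R]_d -> R) (M : R) : continuous f ->
  vanishing M f -> exists C, forall x, `|f x| <= C.
Proof.
move=> cf vf.
have cB : compact [set x : 'rV[R]_d | `|x| <= M].
  apply: bounded_closed_compact.
    exists M; split; first exact: num_real.
    by move=> N MN x /= /le_trans; apply; exact: ltW.
  have -> : [set x : 'rV[R]_d | `|x| <= M] = (fun x => `|x|) @^-1` [set y : R | y <= M].
    by [].
  apply: preimage_closed; last exact: closed_le.
  by move=> x _; exact: norm_continuous.
have /compact_bounded[C [_ HC]] : compact (f @` [set x : 'rV[R]_d | `|x| <= M]).
  by apply: continuous_compact => //; exact: continuous_subspaceT.
exists (Num.max 0 (C + 1)) => x.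
have [xM|/ltW xM] := leP `|x| M; last by rewrite vf// normr0 le_max lexx.
rewrite le_max; apply/orP; right; apply: HC; first by rewrite ltrDl.
by exists x.
Qed.

Lemma integrable_continuous {d} (f : 'rV[R]_d -> R) (M : R) : continuous f ->
  vanishing M f ->
  (lebesgue_tuple d).-integrable setT (fun t => (f (rV_of_tuple t))%:E).
Proof.
move=> cf vf; have [C HC] := continuous_bounded cf vf.
have mf := measurable_continuous cf.
rewrite (_ : (fun t => _) = (EFin \o (fun t => f (rV_of_tuple t))) \_ (box M d)).
  rewrite -[X in _.-integrable X]/setT.
  rewrite -integrable_mkcond; last exact: measurable_box.
  apply: measurable_bounded_integrable; [exact: measurable_box|exact: lebesgue_tuple_box| |].
    exact: measurable_funTS.
  exists C; split; first exact: num_real.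
  by move=> y Cy t _ /=; rewrite (le_trans (HC _))// ltW.
apply/funext => t; rewrite patchE; case: ifPn => // /negP.
rewrite inE => tM; rewrite vf//.
have /existsNP[i ti] : ~ forall i, tnth t i \in `[- M, M] by [].
apply: le_trans (coord_le_norm _ i); rewrite mxE.
by move: ti; rewrite in_itv /= -ler_norml => /negP; rewrite -ltNge => /ltW.
Qed.

End compactly_supported.

(** * Partial derivatives of compactly supported functions integrate to zero *)

Section integral_of_partial.
Context {R : realType}.

(** A derivative depends on a whole neighbourhood, so the radius has to grow; the margin [1] is
    arbitrary. *)
Lemma vanishing_partial {d} (f : 'rV[R]_d -> R) (M : R) j : vanishing M f ->
  vanishing (M + 1) (partial j f).
Proof.
move=> vf x Mx; rewrite /partial (@near_eq_derive _ _ _ _ (cst 0)) ?derive_cst//.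
have xM : M < `|x| by rewrite (lt_le_trans _ Mx)// ltrDl.
have : \forall y \near x, M < `|y|.
  by have /cvgr_gt/(_ _ xM) := @norm_continuous _ _ x.
by apply: filterS => y /ltW; exact: vf.
Qed.

Lemma integral_derive_compact (g g' : R -> R) (M : R) :
  (forall x : R, is_derive x 1 g (g' x)) -> continuous g' ->
  (forall x, M <= `|x| -> g x = 0) ->
  (\int[lebesgue_measure]_x (g' x)%:E = 0)%E.
Proof.
move=> dg cg' g0; pose N := `|M| + 1.
have N0 : 0 < N by rewrite ltr_wpDl.
have MN : M <= N by rewrite (le_trans (ler_norm M))// lerDl.
have cg : continuous g.
  by move=> x; apply/differentiable_continuous/derivable1_diffP; case: (dg x).
have gN x : N <= `|x| -> g x = 0 by move=> Nx; rewrite g0// (le_trans MN).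
have g'N x : N < `|x| -> g' x = 0.
  move=> Nx; case: (dg x) => _ <-.
  rewrite (@near_eq_derive _ _ _ _ (cst 0)) ?derive_cst//.
  have : \forall y \near x, N < `|y| by have /cvgr_gt/(_ _ Nx) := @norm_continuous _ _ x.
  by apply: filterS => y /ltW; exact: gN.
rewrite (_ : (fun x => _) = (EFin \o g') \_ `[- N, N]); last first.
  apply/funext => x; rewrite patchE; case: ifPn => // /negP.
  rewrite inE /= in_itv /= -ler_norml => /negP; rewrite -ltNge => Nx.
  by rewrite g'N.
rewrite -integral_mkcond/= (@continuous_FTC2 _ g' g).
- by rewrite !gN ?normrN ?gtr0_norm//; rewrite subee.
- by rewrite gtrN.
- exact: continuous_subspaceT.
- split; first by move=> x _; case: (dg x).
    exact/cvg_at_right_filter/cg.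
  exact/cvg_at_left_filter/cg.
- by move=> x _; rewrite derive1E; case: (dg x).
Qed.

Section cons_row.
Context {n : nat}.
Local Notation e j := (delta_mx ord0 j).

(** Written on the canonical basis so that translations along basis vectors pass through it, which
    makes the difference quotients of a slice those of the function itself. *)
Definition cons_row (x : R) (y : 'rV[R]_n) : 'rV[R]_n.+1 :=
  x *: e ord0 + \sum_k y ord0 k *: e (lift ord0 k).

Lemma cons_rowE0 x y : cons_row x y ord0 ord0 = x.
Proof.
rewrite /cons_row !mxE summxE big1 ?eqxx ?mulr1 ?addr0// => k _.
by rewrite !mxE mulr0.
Qed.

Lemma cons_rowES x y k : cons_row x y ord0 (lift ord0 k) = y ord0 k.
Proof.
rewrite /cons_row !mxE mulr0 add0r summxE (bigD1 k)//= !mxE !eqxx mulr1.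
by rewrite big1 ?addr0// => l lk; rewrite !mxE (inj_eq lift_inj) eq_sym (negPf lk) mulr0.
Qed.

Lemma rV_of_tuple_cons x (t : n.-tuple (measurableTypeR R)) :
  rV_of_tuple (tuple_of_pair (x, t)) = cons_row x (rV_of_tuple t).
Proof.
apply/rowP => i; rewrite mxE; have [->|] := eqVneq i ord0.
  by rewrite tnth0 cons_rowE0.
by rewrite eq_sym => /unlift_some[k -> _]; rewrite tnthS cons_rowES mxE.
Qed.

Lemma cons_rowDl (h x : R) y : cons_row (h + x) y = h *: e ord0 + cons_row x y.
Proof. by rewrite /cons_row scalerDl addrA. Qed.

Lemma cons_rowDr (h x : R) y k :
  cons_row x (h *: e k + y) = h *: e (lift ord0 k) + cons_row x y.
Proof.
rewrite /cons_row addrCA; congr +%R.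
under eq_bigr do rewrite !mxE scalerDl.
rewrite big_split /= (bigD1 k)//= !eqxx mulr1 big1 ?addr0// => l lk.
by rewrite (negPf lk) mulr0 scale0r.
Qed.

Lemma continuous_cons_rowl y : continuous (cons_row ^~ y).
Proof.
move=> x; apply: cvgD; last exact: cvg_cst.
by apply: cvgZr_tmp; exact: cvg_id.
Qed.

Lemma continuous_cons_rowr x : continuous (cons_row x).
Proof.
move=> y; apply: (@continuousD _ _ _ (fun=> x *: e ord0)
  (fun y : 'rV[R]_n => \sum_k y ord0 k *: (e (lift ord0 k) : 'rV[R]_n.+1))).
  exact: cst_continuous.
apply: (@cvg_big _ _ _ _ _ _ _ (nbhs y)) => [z|k _].
- exact: add_continuous.
- by apply: cvgZr_tmp; exact: coord_continuous.
Qed.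

Lemma cons_row_vanishing (f : 'rV[R]_n.+1 -> R) M x : vanishing M f ->
  vanishing M (f \o cons_row x).
Proof.
move=> vf y My; apply: vf; apply: le_trans My _.
rewrite [X in X <= _](_ : _ = mx_norm y)// mx_normrE.
apply: bigmax_le => // -[i j] _ /=; rewrite ord1 -(cons_rowES x).
exact: coord_le_norm.
Qed.

Lemma cons_row_partial (f : 'rV[R]_n.+1 -> R) x k :
  partial k (f \o cons_row x) = partial (lift ord0 k) f \o cons_row x.
Proof.
apply/funext => y; rewrite /partial /derive /=.
by under eq_fun do rewrite cons_rowDr.
Qed.

Lemma Ck1_cons_row (f : 'rV[R]_n.+1 -> R) x : Ck 1 f -> Ck 1 (f \o cons_row x).
Proof.
move=> [cf df pf]; split => [y|k y|k].
- apply: continuous_comp; [exact: continuous_cons_rowr|exact: cf].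
- have := df (lift ord0 k) (cons_row x y).
  by rewrite /derivable /=; under [in X in _ -> X]eq_fun do rewrite cons_rowDr.
- rewrite cons_row_partial => y.
  apply: continuous_comp; [exact: continuous_cons_rowr|exact: (pf _)].
Qed.

End cons_row.

Lemma integral_lebesgue_tupleS n (h : n.+1.-tuple (measurableTypeR R) -> \bar R) :
  (lebesgue_tuple n.+1).-integrable setT h ->
  (lebesgue_measure \x lebesgue_tuple n)%E.-integrable setT
     (h \o @tuple_of_pair R n) /\
  (\int[lebesgue_tuple n.+1]_t h t =
  \int[lebesgue_measure \x lebesgue_tuple n]_p h (tuple_of_pair p))%E.
Proof.
move=> ih; have /integrableP[mh hoo] := ih.
have mt := @measurable_tuple_of_pair R n.
have ihp : (lebesgue_measure \x lebesgue_tuple n)%E.-integrable setT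
     (h \o @tuple_of_pair R n).
  apply/integrableP; split; first exact: measurableT_comp.
  apply: le_lt_trans hoo.
  rewrite [leRHS](eq_measure_integral
    (pushforward (lebesgue_measure \x lebesgue_tuple n)%E (@tuple_of_pair R n)))//.
  rewrite ge0_integral_pushforward//.
  exact: measurableT_comp.
split => //.
rewrite [LHS](eq_measure_integral
    (pushforward (lebesgue_measure \x lebesgue_tuple n)%E (@tuple_of_pair R n)))//.
by rewrite integral_pushforward.
Qed.

(** Induction on the dimension with Fubini. For the first coordinate the inner integral is taken
    along it and vanishes by the fundamental theorem of calculus; for another coordinate the inner
    integral is over the slice with the first one fixed. *)
Lemma integral_partial d j (f : 'rV[R]_d -> R) M : Ck 1 f -> vanishing M f ->
  (\int[lebesgue_tuple d]_t (partial j f (rV_of_tuple t))%:E = 0)%E.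
Proof.
elim: d j f => [[]//|n IH] j f Cf vf; have [cf df pf] := Cf.
have ih := integrable_continuous (pf j) (vanishing_partial j vf).
have [ihp ->] := integral_lebesgue_tupleS ih.
have [j0|] := eqVneq j ord0.
  rewrite -integral21_prod_meas1//=; apply: integral0_eq => t _.
  rewrite /fubini_G /=.
  under eq_integral do rewrite rV_of_tuple_cons.
  set y := rV_of_tuple t.
  have [z cE] : exists z, forall s : R, cons_row s y = s *: delta_mx ord0 ord0 + z.
    by exists (cons_row 0 y) => s; rewrite -cons_rowDl addr0.
  apply: (@integral_derive_compact (fun s => f (cons_row s y)) _ M) => s.
  - under eq_fun do rewrite cE.
    rewrite cE j0; apply: DeriveDef; last by rewrite derive_slice.
    exact/derivable_slice/df.
  - apply: (@continuous_comp _ _ _ (cons_row ^~ y) (partial j f)).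
      exact: continuous_cons_rowl.
    exact: pf.
  - move=> Ms; apply: vf; apply: le_trans Ms _.
    by rewrite -{1}(cons_rowE0 s y); exact: coord_le_norm.
rewrite eq_sym => /unlift_some[k jk _].
rewrite -integral12_prod_meas1//=; apply: integral0_eq => x _.
rewrite /fubini_F /=.
under eq_integral do rewrite rV_of_tuple_cons.
have := IH k (f \o cons_row x) (Ck1_cons_row x Cf) (cons_row_vanishing x vf).
by rewrite cons_row_partial -jk.
Qed.

End integral_of_partial.

(** * Gradients, Laplacians, Hessians and divergences *)

Section vector_calculus.
Context {R : realType} {d : nat}.
Local Notation E := 'rV[R]_d.
Implicit Types (f g h : E -> R) (x : E).

Definition gdot f g x : R := \sum_j partial j f x * partial j g x.

Definition laplacian f x : R := \sum_j partial j (partial j f) x.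

Definition hess f (z w : E) x : R :=
  \sum_j \sum_k partial j (partial k f) x * z ord0 j * w ord0 k.

Lemma gdotC f g x : gdot f g x = gdot g f x.
Proof. by apply: eq_bigr => j _; rewrite mulrC. Qed.

Lemma Cinf_gdot f g : Cinf f -> Cinf g -> Cinf (gdot f g).
Proof. by move=> Cf Cg; apply: Cinf_sum => j; apply: CinfM; exact: Cinf_partial. Qed.

Lemma Cinf_laplacian f : Cinf f -> Cinf (laplacian f).
Proof. by move=> Cf; apply: Cinf_sum => j; do 2 apply: Cinf_partial. Qed.

Lemma gdotDl f g h x : Cinf f -> Cinf g ->
  gdot (fun y => f y + g y) h x = gdot f h x + gdot g h x.
Proof.
move=> Cf Cg; rewrite /gdot -big_split; apply: eq_bigr => j _ /=.
by rewrite partialD ?mulrDl//; exact: Cinf_derivable.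
Qed.

Lemma gdotMl f g h x : Cinf f -> Cinf g ->
  gdot (fun y => f y * g y) h x = f x * gdot g h x + g x * gdot f h x.
Proof.
move=> Cf Cg; rewrite /gdot !mulr_sumr -big_split; apply: eq_bigr => j _ /=.
rewrite partialM; [ring|exact: Cinf_derivable|exact: Cinf_derivable].
Qed.

Lemma gdotZl c f h x : Cinf f -> gdot (fun y => c * f y) h x = c * gdot f h x.
Proof.
move=> Cf; rewrite /gdot mulr_sumr; apply: eq_bigr => j _.
by rewrite partialZ ?mulrA//; exact: Cinf_derivable.
Qed.

Lemma laplacianD f g x : Cinf f -> Cinf g ->
  laplacian (fun y => f y + g y) x = laplacian f x + laplacian g x.
Proof.
move=> Cf Cg; rewrite /laplacian -big_split; apply: eq_bigr => j _ /=.
rewrite (_ : partial j (fun y => f y + g y) = fun y => partial j f y + partial j g y).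
  by rewrite partialD//; apply: Cinf_derivable; exact: Cinf_partial.
by apply/funext => y; rewrite partialD//; exact: Cinf_derivable.
Qed.

Lemma laplacianM f g x : Cinf f -> Cinf g -> laplacian (fun y => f y * g y) x =
  f x * laplacian g x + 2 * gdot f g x + g x * laplacian f x.
Proof.
move=> Cf Cg; rewrite /laplacian /gdot !mulr_sumr -!big_split.
apply: eq_bigr => j _ /=.
rewrite (_ : partial j (fun y => f y * g y) =
  fun y => partial j f y * g y + f y * partial j g y); last first.
  by apply/funext => y; rewrite partialM//; exact: Cinf_derivable.
have Dj h k : Cinf h -> derivable h x (delta_mx ord0 k) by move=> Ch; exact: Cinf_derivable.
have Cjf := Cinf_partial j Cf; have Cjg := Cinf_partial j Cg.
rewrite partialD ?partialM; [|exact: Dj..|exact/Dj/CinfM|exact/Dj/CinfM].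
move: (partial _ (partial _ _) _) (partial _ (partial _ _) _) => a b.
move: (partial _ _ _) (partial _ _ _) => a' b'; ring.
Qed.

Lemma laplacianZ c f x : Cinf f -> laplacian (fun y => c * f y) x = c * laplacian f x.
Proof.
move=> Cf; rewrite /laplacian mulr_sumr; apply: eq_bigr => j _.
rewrite (_ : partial j (fun y => c * f y) = fun y => c * partial j f y).
  by rewrite partialZ//; apply: Cinf_derivable; exact: Cinf_partial.
by apply/funext => y; rewrite partialZ//; exact: Cinf_derivable.
Qed.

Lemma partial_gdot f g j x : Cinf f -> Cinf g -> partial j (gdot f g) x =
  \sum_k (partial j (partial k f) x * partial k g x +
          partial k f x * partial j (partial k g) x).
Proof.
move=> Cf Cg; rewrite partial_sum => [|k]; last by apply: CinfM; exact: Cinf_partial.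
by apply: eq_bigr => k _; rewrite partialM//; apply: Cinf_derivable; exact: Cinf_partial.
Qed.

Lemma gdot_gdot_self f x : Cinf f ->
  gdot f (gdot f f) x = 2 * hess f (grad f x) (grad f x) x.
Proof.
move=> Cf; rewrite /gdot /hess mulr_sumr; apply: eq_bigr => j _.
rewrite partial_gdot// !mulr_sumr; apply: eq_bigr => k _; rewrite !mxE; ring.
Qed.

(** Differentiating the inner [gdot] produces a Hessian of [f] and one of [v]; by symmetry of the
    latter, its term is half the derivative of [|grad v|^2] along [grad f]. *)
Lemma gdot_gdot f v x : Cinf f -> Cinf v ->
  gdot (gdot f v) v x =
  hess f (grad v x) (grad v x) x + 2^-1 * gdot f (gdot v v) x.
Proof.
move=> Cf Cv.
have -> : gdot f (gdot v v) x =
    2 * \sum_k \sum_j partial k f x * (partial j v x * partial k (partial j v) x).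
  rewrite mulr_sumr; apply: eq_bigr => k _; rewrite partial_gdot// !mulr_sumr.
  by apply: eq_bigr => j _; ring.
rewrite mulrA mulVf ?pnatr_eq0// mul1r exchange_big -big_split; apply: eq_bigr => j _ /=.
rewrite partial_gdot// mulr_suml -big_split; apply: eq_bigr => k _ /=.
rewrite !mxE (schwarz j k x Cv).
move: (partial _ (partial _ _) _) (partial _ (partial _ _) _) => a b.
move: (partial _ _ _) (partial _ _ _) (partial _ _ _) => a' b' c'; ring.
Qed.

(** The divergence of the field [f grad g], in expanded form. *)
Definition divergence f g x : R := f x * laplacian g x + gdot f g x.

Lemma Cinf_divergence f g : Cinf f -> Cinf g -> Cinf (divergence f g).
Proof.
by move=> Cf Cg; apply: CinfD; [apply: CinfM => //; exact: Cinf_laplacian|exact: Cinf_gdot].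
Qed.

Lemma divergenceE f g x : Cinf f -> Cinf g ->
  divergence f g x = \sum_j partial j (fun y => f y * partial j g y) x.
Proof.
move=> Cf Cg; rewrite /divergence mulr_sumr -big_split; apply: eq_bigr => j _ /=.
have Cjg := Cinf_partial j Cg.
by rewrite partialM; [rewrite [RHS]addrC|exact: Cinf_derivable|exact: Cinf_derivable].
Qed.

Lemma integral_divergence f g (M : R) : Cinf f -> Cinf g ->
  (vanishing M f \/ vanishing M g) ->
  (lebesgue_tuple d).-integrable setT (fun t => (divergence f g (rV_of_tuple t))%:E) /\
  (\int[lebesgue_tuple d]_t (divergence f g (rV_of_tuple t))%:E = 0)%E.
Proof.
move=> Cf Cg vfg.
have Cfg j : Cinf (fun y => f y * partial j g y).
  by apply: CinfM => //; exact: Cinf_partial.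
have v j : vanishing (M + 1) (fun y => f y * partial j g y).
  move=> y My; case: vfg => [vf|vg]; last by rewrite (vanishing_partial j vg)// mulr0.
  by rewrite vf ?mul0r// (le_trans _ My)// lerDl.
have ij j : (lebesgue_tuple d).-integrable setT
    (fun t => (partial j (fun y => f y * partial j g y) (rV_of_tuple t))%:E).
  apply: integrable_continuous (vanishing_partial j (v j)).
  exact/Cinf_continuous/Cinf_partial.
have E t : ((divergence f g (rV_of_tuple t))%:E =
    \sum_j (partial j (fun y => f y * partial j g y) (rV_of_tuple t))%:E)%E.
  by rewrite divergenceE// sumEFin.
split; first by under eq_fun do rewrite E; exact: integrable_sum.
under eq_integral do rewrite E.
rewrite integral_sum//; apply: big1 => j _.
by rewrite (integral_partial j (Cfg j 1%N) (v j)).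
Qed.

End vector_calculus.

(** * Gradients of nonnegative functions, and bounds on compact sets *)

Section bounds.
Context {R : realType} {d : nat}.
Local Notation E := 'rV[R]_d.
Implicit Types (f g h : E -> R) (x : E).

Local Notation e j := (delta_mx ord0 j : E).

Lemma slice_MVT f j x (h : R) : Cinf f -> 0 < h ->
  exists2 s, 0 < s < h & f (h *: e j + x) - f x = partial j f (s *: e j + x) * h.
Proof.
move=> Cf h0.
have [|s sh] := @MVT_derivable R (fun t => f (t *: e j + x)) h _ h0.
  by move=> s; apply: derivable_slice; exact: Cinf_derivable.
by rewrite scale0r add0r derive_slice => ->; exists s.
Qed.

(** On the line through [x] along [e j], nonnegativity of [f] makes the quadratic
    [f x + t f' + B t^2] nonnegative for all [t]; evaluating it at its minimum gives the bound. *)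
Lemma partial_sqr_le f (B : R) j x : Cinf f -> (forall y, 0 <= f y) ->
  (forall y, `|partial j (partial j f) y| <= B) ->
  partial j f x ^+ 2 <= 4 * B * f x.
Proof.
move=> Cf f0 fB.
have Cjf := Cinf_partial j Cf.
have B0 : 0 <= B by exact: le_trans (fB x).
have lip y (s : R) : 0 < s ->
    `|partial j f (s *: e j + y) - partial j f y| <= B * s.
  move=> s0; have [r _ ->] := slice_MVT j y Cjf s0.
  by rewrite normrM (gtr0_norm s0) ler_wpM2r// ltW.
have taylor (t : R) : 0 <= f x + t * partial j f x + B * t ^+ 2.
  have [t0|t0|->] := ltgtP t 0; last by rewrite mul0r expr0n /= mulr0 !addr0.
  - have nt0 : 0 < - t by rewrite oppr_gt0.
    have [s /andP[s0 st]] := slice_MVT j (t *: e j + x) Cf nt0.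
    set y := s *: e j + _ => Es.
    have ts0 : 0 < - (s + t) by lra.
    have := lip y _ ts0.
    have -> : - (s + t) *: e j + y = x.
      by rewrite /y [s *: _ + _]addrA -scalerDl addrA -scalerDl addNr scale0r add0r.
    move: Es (f0 (t *: e j + x)).
    rewrite addrA -scalerDl addNr scale0r add0r ler_norml.
    move: (f _) (f x) (partial j f y) (partial j f x) => fy fx py px Es fy0 /andP[l1 l2].
    have Bs := mulr_ge0 B0 (ltW s0).
    have : (px - py) * - t <= (B * - t) * - t by apply: ler_wpM2r; lra.
    by rewrite expr2; lra.
  - have [s /andP[s0 st]] := slice_MVT j x Cf t0.
    have := lip x s s0; rewrite ler_norml.
    move: (f0 (t *: e j + x)).
    move: (f _) (f x) (partial j f _) (partial j f x) => fy fx py px fy0 /andP[l1 l2] Es.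
    have Bs : 0 <= B * (t - s) by rewrite mulr_ge0// subr_ge0 ltW.
    have : (py - px) * t <= (B * t) * t by apply: ler_wpM2r; lra.
    by rewrite expr2; lra.
have [B00|Bp] := eqVneq B 0.
  have {}taylor (t : R) : 0 <= f x + t * partial j f x.
    by have := taylor t; rewrite B00 mul0r addr0.
  rewrite B00 mulr0 mul0r.
  have [->|p0] := eqVneq (partial j f x) 0; first by rewrite expr0n.
  (* For this [t] the affine lower bound would equal [-1]. *)
  have := taylor (- (f x + 1) / partial j f x).
  by rewrite divfK// opprD addrA subrr add0r ler0N1.
have {}B0 : 0 < B by rewrite lt_neqAle eq_sym Bp.
have := taylor (- partial j f x / (2 * B)).
move: (partial j f x) (f x) => p fx Hp.
have -> : p ^+ 2 = 4 * B * fx - 4 * B * (fx + - p / (2 * B) * p + B * (- p / (2 * B)) ^+ 2).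
  by field; rewrite gt_eqF.
by rewrite gerBl mulr_ge0// mulr_ge0// ltW.
Qed.

Lemma compact_bounded_fun (A : set E) f : compact A -> {in A, continuous f} ->
  exists2 B, 0 < B & forall x, A x -> `|f x| <= B.
Proof.
move=> cA cf; have /compact_bounded[C [_ HC]] : compact (f @` A).
  by apply: continuous_compact => //; exact: continuous_in_subspaceT.
exists (Num.max 1 (C + 1)); first by rewrite lt_max ltr01.
move=> x Ax; rewrite le_max; apply/orP; right; apply: HC; first by rewrite ltrDl.
by exists x.
Qed.

Lemma compact_bounded_funs (I : finType) (A : set E) (F : I -> E -> R) :
  compact A -> (forall i, {in A, continuous (F i)}) ->
  exists2 B, 0 < B & forall i x, A x -> `|F i x| <= B.
Proof.
move=> cA cF.
have /choice[b Hb] : forall i, exists b, forall x, A x -> `|F i x| <= b.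
  by move=> i; have [b _ Hb] := compact_bounded_fun cA (cF i); exists b.
exists (1 + \sum_i `|b i|); first by rewrite ltr_pwDl// sumr_ge0.
move=> i x Ax; rewrite (le_trans (Hb i x Ax))// (le_trans (ler_norm _))//.
by rewrite (bigD1 i)//= addrCA lerDl addr_ge0// sumr_ge0.
Qed.

End bounds.

(** * The Poisson bracket and the Hessian orthogonally to the gradient *)

Section convexity.
Context {R : realType} {d : nat}.
Local Notation E := 'rV[R]_d.
Implicit Types (f g h : E -> R) (x : E).

Local Notation e j := (delta_mx ord0 j : E).

Lemma is_derive_coord j k x :
  is_derive x (e j) (fun y : E => y ord0 k) (j == k)%:R.
Proof.
pose s (h : R) := h * (j == k)%:R + x ord0 k.
have sE : (fun h : R => (h *: e j + x) ord0 k) = s.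
  by apply/funext => h; rewrite /s !mxE eqxx eq_sym.
have ds : is_derive (0 : R) 1 s (j == k)%:R.
  have -> : s = (fun h : R => h * (j == k)%:R) + cst (x ord0 k) by [].
  apply: is_derive_eq; by rewrite /= !addr0 scaler0 add0r /GRing.scale /= mulr1.
apply: DeriveDef; first by apply/derivable1P; rewrite sE; case: ds.
have := @derive_slice R d (fun y : E => y ord0 k) x (e j) 0.
rewrite scale0r add0r => <-.
by rewrite sE; case: ds.
Qed.

Lemma partial_coord j k x : partial j (fun y : E => y ord0 k) x = (j == k)%:R.
Proof. by case: (is_derive_coord j k x). Qed.

Lemma Cinf_coord k : Cinf (fun y : E => y ord0 k).
Proof.
case=> [|n]; first exact: coord_continuous.
split; first exact: coord_continuous.
  by move=> j x; case: (is_derive_coord j k x).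
move=> j; rewrite (_ : partial j _ = fun=> (j == k)%:R); first exact: Ck_cst.
by apply/funext => x; rewrite partial_coord.
Qed.

Lemma dot_ge0 (z : E) : 0 <= dot z z.
Proof. by apply: sumr_ge0 => j _; rewrite -expr2 sqr_ge0. Qed.

Lemma enorm_sqr (z : E) : enorm z ^+ 2 = dot z z.
Proof. by rewrite sqr_sqrtr// dot_ge0. Qed.

Lemma gdotE f g x : gdot f g x = dot (grad f x) (grad g x).
Proof. by apply: eq_bigr => j _; rewrite !mxE. Qed.

(** This links the hypothesis on symbols to the energy method: the same two Hessian terms appear in
    [carleman_form], with [grad v] in place of [xi]. *)
Lemma poisson_symbols phi tau x xi : Cinf phi ->
  poisson (q2 phi tau) (q1 phi tau) x xi =
  4 * tau * (hess phi xi xi x + tau ^+ 2 * hess phi (grad phi x) (grad phi x) x).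
Proof.
move=> Cphi.
have q2xi j : partial j (q2 phi tau x) xi = 2 * xi ord0 j.
  rewrite /q2; under eq_fun do rewrite enorm_sqr.
  have C1 k : Cinf (fun y : E => y ord0 k * y ord0 k).
    by apply: CinfM; exact: Cinf_coord.
  rewrite partialB; [|exact: (Cinf_derivable (Cinf_sum _ C1))|exact: derivable_cst].
  rewrite partial_cst subr0 partial_sum// (bigD1 j)//= big1 => [|k kj].
    rewrite addr0 partialM; [|exact/Cinf_derivable/Cinf_coord..].
    by rewrite !partial_coord eqxx mul1r mulr1 mulr_natl mulr2n.
  rewrite partialM; [|exact/Cinf_derivable/Cinf_coord..].
  by rewrite !partial_coord eq_sym (negPf kj) mul0r mulr0 addr0.
have q1x j : partial j ((q1 phi tau)^~ xi) x =
    2 * tau * \sum_k partial j (partial k phi) x * xi ord0 k.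
  rewrite /q1 /dot.
  have C1 k : Cinf (fun y => xi ord0 k * grad phi y ord0 k).
    apply: CinfM; first exact: Cinf_cst.
    by under eq_fun do rewrite mxE; exact: Cinf_partial.
  rewrite partialZ; last exact: (Cinf_derivable (Cinf_sum _ C1)).
  congr (_ * _); rewrite partial_sum//; apply: eq_bigr => k _.
  under eq_fun do rewrite mxE.
  rewrite partialZ; first by rewrite mulrC.
  exact/Cinf_derivable/Cinf_partial.
have q2x j : partial j ((q2 phi tau)^~ xi) x =
    - (2 * tau ^+ 2 * \sum_k partial j (partial k phi) x * partial k phi x).
  rewrite /q2.
  under eq_fun do rewrite !enorm_sqr -gdotE.
  have Cg := Cinf_gdot Cphi Cphi.
  rewrite partialB; [|exact: derivable_cst|]; last first.
    by apply: Cinf_derivable; apply: CinfM => //; exact: Cinf_cst.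
  rewrite partial_cst sub0r partialZ; last exact: Cinf_derivable.
  rewrite partial_gdot//.
  have -> : \sum_k (partial j (partial k phi) x * partial k phi x +
      partial k phi x * partial j (partial k phi) x) =
      2 * \sum_k partial j (partial k phi) x * partial k phi x.
    rewrite mulr_sumr; apply: eq_bigr => k _.
    by rewrite [X in _ + X]mulrC mulr_natl mulr2n.
  by rewrite mulrA [tau ^+ 2 * 2]mulrC.
have q1xi j : partial j (q1 phi tau x) xi = 2 * tau * partial j phi x.
  rewrite /q1 /dot.
  have C1 k : Cinf (fun y : E => y ord0 k * grad phi x ord0 k).
    by apply: CinfM; [exact: Cinf_coord|exact: Cinf_cst].
  rewrite partialZ; last exact: (Cinf_derivable (Cinf_sum _ C1)).
  congr (_ * _); rewrite partial_sum// (bigD1 j)//= big1 => [|k kj].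
    rewrite partialM; [|exact/Cinf_derivable/Cinf_coord|exact: derivable_cst].
    by rewrite partial_coord partial_cst eqxx mul1r mulr0 !addr0 mxE.
  rewrite partialM; [|exact/Cinf_derivable/Cinf_coord|exact: derivable_cst].
  by rewrite partial_coord partial_cst eq_sym (negPf kj) mul0r mulr0 addr0.
rewrite /poisson /hess [tau ^+ 2 * _]mulr_sumr -big_split mulr_sumr.
apply: eq_bigr => j _; rewrite q2xi q1x q2x q1xi /=.
have -> : \sum_k partial j (partial k phi) x * xi ord0 j * xi ord0 k =
   xi ord0 j * \sum_k partial j (partial k phi) x * xi ord0 k.
  by rewrite mulr_sumr; apply: eq_bigr => k _; rewrite mulrCA mulrA.
have -> : \sum_k partial j (partial k phi) x * grad phi x ord0 j * grad phi x ord0 k =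
   partial j phi x * \sum_k partial j (partial k phi) x * partial k phi x.
  by rewrite mulr_sumr; apply: eq_bigr => k _; rewrite !mxE mulrCA mulrA.
move: (\sum_k _) (\sum_k _) (partial _ _ _) (xi _ _) => a b p z; ring.
Qed.

Lemma dotC (z w : E) : dot z w = dot w z.
Proof. by apply: eq_bigr => j _; rewrite mulrC. Qed.

Lemma dotDl (z z' w : E) : dot (z + z') w = dot z w + dot z' w.
Proof. by rewrite /dot -big_split; apply: eq_bigr => j _; rewrite mxE mulrDl. Qed.

Lemma dotZl (t : R) (z w : E) : dot (t *: z) w = t * dot z w.
Proof. by rewrite /dot mulr_sumr; apply: eq_bigr => j _; rewrite mxE mulrA. Qed.

Lemma hessDl f z z' w x : hess f (z + z') w x = hess f z w x + hess f z' w x.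
Proof.
rewrite /hess -big_split; apply: eq_bigr => j _ /=.
by rewrite -big_split; apply: eq_bigr => k _; rewrite mxE mulrDr mulrDl.
Qed.

Lemma hessDr f z w w' x : hess f z (w + w') x = hess f z w x + hess f z w' x.
Proof.
rewrite /hess -big_split; apply: eq_bigr => j _ /=.
by rewrite -big_split; apply: eq_bigr => k _; rewrite mxE mulrDr.
Qed.

Lemma hessZl f t z w x : hess f (t *: z) w x = t * hess f z w x.
Proof.
rewrite /hess mulr_sumr; apply: eq_bigr => j _.
by rewrite mulr_sumr; apply: eq_bigr => k _; rewrite mxE !mulrA [_ * t]mulrC.
Qed.

Lemma hessZr f t z w x : hess f z (t *: w) x = t * hess f z w x.
Proof.
rewrite /hess mulr_sumr; apply: eq_bigr => j _.
by rewrite mulr_sumr; apply: eq_bigr => k _; rewrite mxE mulrCA.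
Qed.

(** Young's inequality [|a b| <= r a^2 + b^2 / (4 r)] on each entry; each square occurs in [d]
    entries, whence the factor [d]. *)
Lemma hess_le f (B r : R) (z w : E) x : 0 < r ->
  (forall j k, `|partial j (partial k f) x| <= B) ->
  `|hess f z w x| <= B * d%:R * (r * dot z z + dot w w / (4 * r)).
Proof.
move=> r0 fB.
have -> : B * d%:R * (r * dot z z + dot w w / (4 * r)) =
    \sum_j \sum_k B * (r * z ord0 j ^+ 2 + w ord0 k ^+ 2 / (4 * r)).
  under eq_bigr do rewrite -mulr_sumr big_split /= sumr_const card_ord -mulr_suml.
  rewrite -mulr_sumr big_split /= sumr_const card_ord -mulrA; congr (_ * _).
  rewrite mulrDr; congr (_ + _); last by rewrite mulr_natl.
  rewrite /dot mulr_natl mulr_sumr -sumrMnl; apply: eq_bigr => j _.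
  by rewrite expr2.
rewrite /hess (le_trans (ler_norm_sum _ _ _))//; apply: ler_sum => j _.
rewrite (le_trans (ler_norm_sum _ _ _))//; apply: ler_sum => k _.
rewrite -mulrA normrM; apply: ler_pM => //.
move: (z _ _) (w _ _) => a b; rewrite ler_norml.
have r4 : 4 * r != 0 by rewrite mulf_neq0// ?pnatr_eq0 ?gt_eqF.
apply/andP; split; rewrite -subr_ge0.
  rewrite (_ : _ - _ = (2 * r * a + b) ^+ 2 / (4 * r)); last by field; rewrite ?gt_eqF.
  by rewrite divr_ge0 ?sqr_ge0// mulr_ge0// ltW.
rewrite (_ : _ - _ = (2 * r * a - b) ^+ 2 / (4 * r)); last by field; rewrite ?gt_eqF.
by rewrite divr_ge0 ?sqr_ge0// mulr_ge0// ltW.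
Qed.

(* By homogeneity, the condition at [tau = 1] and [xi] proportional to [z] with
   [|xi| = |grad phi|] controls the Hessian in every direction [z] orthogonal to [grad phi]. *)
Lemma sub_elliptic_orthogonal V phi : Cinf phi -> sub_elliptic V phi ->
  exists2 c : R, 0 < c & forall x z, closure V x -> dot (grad phi x) z = 0 ->
    dot z z * (c * Num.sqrt (gdot phi phi x)
      - hess phi (grad phi x) (grad phi x) x / gdot phi phi x) <= hess phi z z x.
Proof.
move=> Cphi [F0 [c c0 Hc]].
exists (c / 4); first by rewrite divr_gt0.
move=> x z Vx oz; have := F0 x Vx.
rewrite -(@pmulr_rgt0 _ (enorm (grad phi x))) ?F0// -expr2 enorm_sqr -gdotE => Fp.
set F := gdot phi phi x in Fp *; set H := hess phi _ _ x.
have [z0|z0] := eqVneq (dot z z) 0.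
  have -> : z = 0.
    apply/rowP => j; rewrite mxE; apply/eqP; rewrite -sqrf_eq0.
    have := z0; rewrite /dot => /eqP; rewrite psumr_eq0; last by move=> i _; rewrite -expr2 sqr_ge0.
    by move=> /allP/(_ j); rewrite mem_index_enum => /(_ isT)/=; rewrite -expr2.
  by rewrite -(scale0r 0) dotZl hessZl !mul0r.
have zp : 0 < dot z z by rewrite lt_neqAle eq_sym z0 dot_ge0.
pose r := Num.sqrt (F / dot z z).
have r2 : r ^+ 2 = F / dot z z by rewrite sqr_sqrtr// divr_ge0// ltW.
have q20 : q2 phi 1 x (r *: z) = 0.
  rewrite /q2 !enorm_sqr -gdotE -/F expr1n mul1r.
  by rewrite dotZl dotC dotZl mulrA -expr2 r2 divfK// subrr.
have q10 : q1 phi 1 x (r *: z) = 0 by rewrite /q1 dotZl dotC oz !mulr0.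
have := Hc x (r *: z) 1 Vx ltr01 q20 q10.
rewrite poisson_symbols// hessZl hessZr [r * (r * _)]mulrA -expr2 r2 expr1n mul1r mulr1 -/H.
(* The power 3/2 is bounded below by dropping the [1] coming from [tau]. The factor [F] then cancels
   that of [r^2 = F / |z|^2], leaving [sqrt F]. *)
have FF : F * Num.sqrt F <= (enorm (r *: z) ^+ 2 + 1) `^ (3 / 2).
  have -> : enorm (r *: z) ^+ 2 = F.
    by rewrite enorm_sqr dotZl dotC dotZl mulrA -expr2 r2 divfK.
  apply: (@le_trans _ _ (F `^ (3 / 2))); last first.
    by apply: ge0_ler_powR; rewrite ?nnegrE ?lerDl ?addr_ge0 ?divr_ge0 ?ltW.
  have -> : 3 / 2 = 1 + 2^-1 :> R by lra.
  rewrite powRD; last by rewrite (gt_eqF Fp) implybT.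
  by rewrite powRr1 ?powR12_sqrt ?(ltW Fp).
move: (hess _ _ _ _) (Num.sqrt F) ((_ + 1) `^ _) FF => h sF P FF Hh.
have : c * (F * sF) <= 4 * (F / dot z z * h + H).
  by apply: le_trans Hh; rewrite ler_pM2l.
rewrite -(ler_pM2r (x := dot z z / (4 * F))); last by rewrite divr_gt0// mulr_gt0.
move: (dot z z) zp => S Sp; move: F Fp H {z0 r r2 q20 q10 Hh FF} => F Fp H.
rewrite (_ : 4 * _ * _ = h + S * (H / F)); last by field; rewrite !gt_eqF.
rewrite (_ : c * (F * sF) * _ = S * (c / 4 * sF)); last by field; rewrite !gt_eqF.
by rewrite mulrBr lerBlDr.
Qed.

End convexity.

(** * Construction of the function [mu] *)

Section convexifier.
Context {R : realType} {d : nat}.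
Local Notation E := 'rV[R]_d.
Implicit Types (x z : E).

(* [S = |z'|^2] and [T = t^2 F] for the orthogonal splitting [z = z' + t grad phi],
   [h] is the Hessian on [z'] and [X] collects the cross terms. *)
Lemma convexity_arith (c B r S T h H X F N C : R) :
  0 < c -> 1 <= B -> 0 <= S -> 0 <= T -> F^-1 <= B -> 0 < F -> `|H| <= B ->
  F * T = N ^+ 2 -> r = c / (8 * B ^+ 3) ->
  S * (2 * c - H / F) <= h ->
  `|X| <= c / 2 * S + C * T -> 0 <= C ->
  c * (S + T) - (B * (3 * c + C + 2 * B ^+ 2)) * N ^+ 2 <=
   h + X + T / F * H + (H / (F + r) - c / 4) * (S + T).
Proof.
move=> c0 B1 S0 T0 FB F0 HB FT rE Hh XB C0.
have B0 : 0 < B by exact: lt_le_trans B1.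
have r0 : 0 < r by rewrite rE divr_gt0// mulr_gt0// exprn_gt0.
have Fr0 : 0 < F + r by rewrite addr_gt0.
have iF0 : 0 < F^-1 by rewrite invr_gt0.
have iFr : (F + r)^-1 <= F^-1 by rewrite lef_pV2 ?posrE// lerDl ltW.
have iFr0 : 0 < (F + r)^-1 by rewrite invr_gt0.
have HF : `|H / F| <= B ^+ 2.
  by rewrite normrM expr2 ler_pM// gtr0_norm.
have HFr : `|H / (F + r)| <= B ^+ 2.
  by rewrite normrM expr2 ler_pM// gtr0_norm// (le_trans iFr).
(* Regularizing [F] to [F + r] costs at most [B r B^2], which determines [r]. *)
have diff : `|H / F - H / (F + r)| <= c / 8.
  rewrite (_ : _ - _ = H * r * (F^-1 * (F + r)^-1)); last by field; rewrite !gt_eqF.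
  rewrite !normrM !(gtr0_norm r0) (gtr0_norm iF0) (gtr0_norm iFr0).
  apply: (@le_trans _ _ (B * r * (B * B))).
    apply: ler_pM; rewrite ?mulr_ge0 ?(ltW r0) ?(ltW iF0) ?(ltW iFr0)//.
      by rewrite ler_pM2r.
    by apply: ler_pM; rewrite ?(ltW iF0) ?(ltW iFr0)// (le_trans iFr).
  by rewrite rE le_eqVlt; apply/orP; left; apply/eqP; field; rewrite gt_eqF.
(* Nothing is known of the sign along [grad phi]: all terms in [T] are charged to [N ^+ 2]. *)
have TN : T <= B * N ^+ 2.
  rewrite -FT -[leLHS](mulKf (lt0r_neq0 F0)) ler_wpM2r// mulr_ge0// ltW//.
rewrite (_ : T / F * H = T * (H / F)); last by rewrite mulrAC mulrA.
move: (H / F) (H / (F + r)) HF HFr diff Hh => p q.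
rewrite !ler_norml => /andP[p1 p2] /andP[q1 q2] /andP[d1 d2] Hh.
have {}TN : T * (3 * c + C + 2 * B ^+ 2) <= B * N ^+ 2 * (3 * c + C + 2 * B ^+ 2).
  by rewrite ler_wpM2r// addr_ge0 ?mulr_ge0 ?exprn_ge0 ?addr_ge0 ?mulr_ge0// ltW.
move: XB; rewrite ler_norml => /andP[X1 X2].
have := ler_wpM2l S0 d2; have := ler_wpM2l T0 p1; have := ler_wpM2l T0 q1.
have := mulr_ge0 T0 (ltW c0); have := mulr_ge0 S0 (ltW c0).
move: (B ^+ 2) (N ^+ 2) TN => B2 N2 TN; nra.
Qed.

Lemma Cinf_continuous_in (A : set E) (f : E -> R) : Cinf f -> {in A, continuous f}.
Proof. by move=> Cf x _; exact: Cinf_continuous. Qed.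

Lemma convexifier_exists V phi : Cinf phi -> compact (closure V) ->
  sub_elliptic V phi ->
  exists (mu : E -> R) (c M : R), [/\ Cinf mu, 0 < c, 0 <= M &
    forall x, closure V x ->
      (forall z, c * dot z z - M * dot (grad phi x) z ^+ 2 <=
                 hess phi z z x + mu x * dot z z) /\
      c <= hess phi (grad phi x) (grad phi x) x - mu x * gdot phi phi x].
Proof.
move=> Cphi cV sV; have [c' c'0 Hc] := sub_elliptic_orthogonal Cphi sV.
pose F := gdot phi phi.
have CF : Cinf F by exact: Cinf_gdot.
have F0 x : closure V x -> 0 < F x.
  move=> Vx; rewrite /F gdotE -enorm_sqr exprn_gt0//; exact: sV.1.
pose H x := 2^-1 * gdot phi F x.
have CH : Cinf H by apply: CinfM; [exact: Cinf_cst|exact: Cinf_gdot].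
have HE x : H x = hess phi (grad phi x) (grad phi x) x.
  by rewrite /H gdot_gdot_self// mulrA mulVf ?mul1r// pnatr_eq0.
have [B1 B10 FB] : exists2 B, 0 < B & forall x, closure V x -> `|(F x)^-1| <= B.
  apply: compact_bounded_fun => // x; rewrite inE => Vx.
  by apply: continuousV; [rewrite gt_eqF// F0|exact: Cinf_continuous].
have [B2 B20 HB] := compact_bounded_fun cV (Cinf_continuous_in (A := closure V) CH).
have [B3 B30 PB] := @compact_bounded_funs R d ('I_d * 'I_d)%type (closure V)
  (fun jk => partial jk.1 (partial jk.2 phi)) cV
  (fun jk => Cinf_continuous_in (Cinf_partial jk.1 (Cinf_partial jk.2 Cphi))).
have [B [B_1 B1B B2B B3B]] : exists B, [/\ 1 <= B, B1 <= B, B2 <= B & B3 <= B].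
  by exists (1 + B1 + B2 + B3); split; lra.
have B0 : 0 < B by lra.
(* Since [F >= 1 / B] on [closure V], [2 * m] is a uniform lower bound for [c' sqrt F]. *)
have [m m0 mE] : exists2 m, 0 < m & 2 * m = c' * (Num.sqrt B)^-1.
  exists (c' / 2 * (Num.sqrt B)^-1); last by field; rewrite gt_eqF// sqrtr_gt0.
  by rewrite mulr_gt0 ?invr_gt0 ?sqrtr_gt0// divr_gt0.
(* [r > 0] makes [mu] smooth where [grad phi] vanishes, outside [closure V]. *)
have [r r0 rE] : exists2 r, 0 < r & r = m / (8 * B ^+ 3).
  by exists (m / (8 * B ^+ 3)); rewrite // divr_gt0// mulr_gt0// exprn_gt0.
have F_ge0 x : 0 <= F x by rewrite /F gdotE dot_ge0.
have Fr x : F x + r != 0 by rewrite gt_eqF// ltr_wpDl.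
(* Orthogonally to [grad phi] the Hessian is at least [2 m - H / F], so adding [mu] keeps a margin
   above [m]; the shift [m / 4] is what makes [H - mu F] positive. *)
pose mu x := H x * (F x + r)^-1 - m / 4.
have Cmu : Cinf mu.
  apply: CinfB; last exact: Cinf_cst.
  apply: CinfM => //; apply: Cinf_inv => //.
  by apply: CinfD => //; exact: Cinf_cst.
(* The cross terms will cost [2 B d rho <= m / 2] per unit of [S]; dividing by [d + 1] instead of
   [d] is safe in dimension 0. *)
have [D D0 DE] : exists2 D : R, 0 < D & D = d%:R + 1.
  by exists (d%:R + 1); rewrite // ltr_wpDl.
have [rho rho0 rhoE] : exists2 rho, 0 < rho & rho = m / (4 * B * D).
  by exists (m / (4 * B * D)); rewrite // divr_gt0// !mulr_gt0.
have [C C0 CE] : exists2 C, 0 <= C & C = 2 * B * d%:R / (4 * rho).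
  exists (2 * B * d%:R / (4 * rho)) => //.
  by rewrite divr_ge0// ?mulr_ge0// ltW.
exists mu, (m / (8 * B)), (B * (3 * m + C + 2 * B ^+ 2)); split => //.
- by rewrite divr_gt0// mulr_gt0.
- by rewrite mulr_ge0 ?addr_ge0 ?mulr_ge0 ?exprn_ge0 ?(ltW B0) ?(ltW m0).
move=> x Vx; have Fx := F0 x Vx.
have FxB : (F x)^-1 <= B.
  by apply: le_trans B1B; apply: le_trans (FB x Vx); exact: ler_norm.
have HxB : `|H x| <= B by exact: le_trans (HB x Vx) B2B.
split=> [z|]; last first.
  rewrite -HE -/(F x) /mu.
  (* The last term is at least [m / (4 B)] and the regularization error is at most [m / (8 B)];
     their difference is the constant [c] announced. *)
  have E1 : H x - (H x / (F x + r) - m / 4) * F x =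
      H x * (r / (F x + r)) + m / 4 * F x by field.
  rewrite E1.
  have Fm : B^-1 <= F x by rewrite -[leRHS]invrK lef_pV2 ?posrE ?invr_gt0.
  have rB : r / (F x + r) <= r * B.
    rewrite ler_pM2l// (le_trans _ FxB)// lef_pV2 ?posrE ?lerDl ?ltW//.
    by rewrite addr_gt0.
  have rB' : r * B = m / (8 * B ^+ 2) by rewrite rE; field; rewrite gt_eqF.
  have : - (B * (m / (8 * B ^+ 2))) <= H x * (r / (F x + r)).
    have : `|H x * (r / (F x + r))| <= B * (m / (8 * B ^+ 2)).
      rewrite normrM -rB' ler_pM// gtr0_norm//.
      by apply: divr_gt0 => //; exact: addr_gt0.
    by rewrite ler_norml => /andP[].
  have -> : B * (m / (8 * B ^+ 2)) = m / (8 * B) by field; rewrite gt_eqF.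
  have : m / 4 * B^-1 <= m / 4 * F x by rewrite ler_pM2l// divr_gt0.
  have -> : m / (8 * B) = m / 8 * B^-1 by field; rewrite gt_eqF.
  have : 0 < m / 8 * B^-1 by rewrite mulr_gt0 ?invr_gt0 ?divr_gt0.
  lra.
pose N := dot (grad phi x) z; pose t := N / F x.
have [w wE] : exists w, w = t *: grad phi x by eexists.
have [z' z'E] : exists z', z' = z - w by eexists.
have zE : z = z' + w by rewrite z'E subrK.
have FE : dot (grad phi x) (grad phi x) = F x by rewrite /F gdotE.
have orth : dot (grad phi x) z' = 0.
  rewrite z'E wE dotC dotDl -scaleN1r dotZl dotZl FE /t divfK ?gt_eqF// mulN1r.
  by rewrite dotC subrr.
have orthw : dot w z' = 0 by rewrite wE dotZl orth mulr0.
pose S := dot z' z'; pose T := dot w w.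
have TE : T = t ^+ 2 * F x by rewrite /T wE dotZl dotC dotZl FE expr2 mulrA.
have zz : dot z z = S + T.
  have zw : dot z' w = 0 by rewrite dotC.
  by rewrite {1 2}zE dotDl ![dot _ (z' + w)]dotC !dotDl orthw zw addr0 add0r.
have hz : hess phi z z x =
    hess phi z' z' x + (hess phi z' w x + hess phi w z' x) + T / F x * H x.
  rewrite {1 2}zE hessDl !hessDr -!addrA; congr (_ + (_ + (_ + _))).
  by rewrite wE hessZl hessZr -HE TE mulfK ?gt_eqF// mulrA -expr2.
have T0 : 0 <= T := dot_ge0 w.
have S0 : 0 <= S := dot_ge0 z'.
rewrite zz hz /mu; apply: (@le_trans _ _
    (m * (S + T) - (B * (3 * m + C + 2 * B ^+ 2)) * N ^+ 2)).
  rewrite lerD2r ler_wpM2r ?addr_ge0//.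
  rewrite ler_pdivrMr ?mulr_gt0// ler_peMr ?(ltW m0)//; lra.
apply: (@convexity_arith m B r) => //.
- by rewrite TE /t; field; rewrite gt_eqF.
- apply: le_trans (Hc x z' Vx orth); rewrite ler_wpM2l// -HE -/(F x) lerD2r.
  rewrite mE ler_pM2l// -sqrtrV ?(ltW B0)// ler_sqrt//.
  by rewrite -[leRHS]invrK lef_pV2 ?posrE ?invr_gt0.
- have pB j k : `|partial j (partial k phi) x| <= B.
    by exact: le_trans (PB (j, k) x Vx) B3B.
  have h1 := hess_le z' w rho0 pB.
  (* With its arguments exchanged, the Hessian needs the parameter [(4 * rho)^-1] to yield the same
     weights on [S] and [T]. *)
  have rho'0 : 0 < (4 * rho)^-1 by rewrite invr_gt0 mulr_gt0.
  have h2 := hess_le w z' rho'0 pB.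
  rewrite (le_trans (ler_normD _ _))// (le_trans (lerD h1 h2))//.
  rewrite -/S -/T.
  have -> : B * d%:R * (rho * S + T / (4 * rho)) +
     B * d%:R * ((4 * rho)^-1 * T + S / (4 * (4 * rho)^-1)) =
     2 * B * d%:R * rho * S + C * T.
    by rewrite CE; field; rewrite gt_eqF.
  rewrite lerD2r ler_wpM2r//.
  rewrite (_ : 2 * B * d%:R * rho = m / 2 * (d%:R / D)); last first.
    by rewrite rhoE; field; rewrite !gt_eqF.
  by rewrite ger_pMr ?divr_gt0// ler_pdivrMr// mul1r DE lerDl.
Qed.

End convexifier.

(** * Lower bound of the Carleman form for one real component *)

Section carleman.
Context {R : realType}.

(* [v] and [v'] are the two real components of the conjugated function; the small
   parameter [r] absorbs the terms of lower order in [tau]. *)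
Lemma component_lower (c M B r tau v v' T N G hv Q e L k q s : R) :
  0 < c -> 0 <= M -> 1 <= tau -> 0 <= G -> 0 <= B ->
  c * G - M * N ^+ 2 <= hv -> c <= Q ->
  2 * tau * N = T - tau * L * v + q * v' ->
  e ^+ 2 <= B * G -> L ^+ 2 <= B -> k ^+ 2 <= B -> B <= r * tau ->
  q ^+ 2 <= r * tau ^+ 4 -> - (r * tau ^+ 2) <= s -> 6 * M <= tau ->
  (3 / 2 * M + c^-1 + 2) * r <= c / 4 ->
  2^-1 * T ^+ 2 + 7 / 4 * c * (tau * G + tau ^+ 3 * v ^+ 2)
    - c / 4 * (tau ^+ 3 * v' ^+ 2) <=
  T ^+ 2 + 2 * tau * hv + 2 * tau ^+ 3 * Q * v ^+ 2 + tau * v * e +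
    tau * s * v ^+ 2 + tau * k * v * T.
Proof.
move=> c0 M0 t1 G0 B0 Hhv HQ HN He HL Hk HB Hq Hs HM Hr.
have t0 : 0 < tau by lra.
have v2 : 0 <= v ^+ 2 := sqr_ge0 v.
have v'2 : 0 <= v' ^+ 2 := sqr_ge0 v'.
have t3 : 0 < tau ^+ 3 by rewrite exprn_gt0.
have t2 : 0 < tau ^+ 2 by rewrite exprn_gt0.
have r0 : 0 <= r by rewrite -(pmulr_lge0 _ t0); exact: le_trans HB.
have t23 : tau ^+ 2 <= tau ^+ 3 by rewrite [tau ^+ 3]exprS ler_peMl// ltW.
have Btau : tau ^+ 2 * B <= r * tau ^+ 3.
  by rewrite (_ : r * tau ^+ 3 = tau ^+ 2 * (r * tau)); [rewrite ler_pM2l|ring].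
have Btau1 : tau * B <= r * tau ^+ 3.
  apply: le_trans Btau; rewrite expr2 -mulrA ler_peMl//.
  by rewrite mulr_ge0// ltW.
(* Young's inequality on each error term *)
have NE : 2 * tau * (M * N ^+ 2) <= 4^-1 * T ^+ 2 +
    3 / 2 * M * (r * (tau ^+ 3 * v ^+ 2) + r * (tau ^+ 3 * v' ^+ 2)).
  (* [N] is expressed through [T], [v] and [v']; thanks to [6 * M <= tau] this spends only a quarter
     of [T ^+ 2]. *)
  have sq : (2 * tau * N) ^+ 2 <= 3 * (T ^+ 2 + tau ^+ 2 * B * v ^+ 2 + q ^+ 2 * v' ^+ 2).
    have LB : (tau * L * v) ^+ 2 <= tau ^+ 2 * B * v ^+ 2.
      by rewrite !exprMn ler_wpM2r// ler_pM2l.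
    rewrite HN -exprMn.
    apply: (@le_trans _ _ (3 * (T ^+ 2 + (tau * L * v) ^+ 2 + (q * v') ^+ 2))).
      move: (tau * L * v) (q * v') => a b.
      rewrite -subr_ge0 (_ : _ - _ = (T + a) ^+ 2 + (T - b) ^+ 2 + (a + b) ^+ 2); last by ring.
      by rewrite !addr_ge0 ?sqr_ge0.
    lra.
  have q2 : q ^+ 2 * v' ^+ 2 <= r * tau ^+ 4 * v' ^+ 2 by rewrite ler_wpM2r.
  have B2 : tau ^+ 2 * B * v ^+ 2 <= r * tau ^+ 3 * v ^+ 2 by rewrite ler_wpM2r.
  have B3 : r * tau ^+ 3 * v ^+ 2 <= r * tau ^+ 4 * v ^+ 2.
    by rewrite ler_wpM2r// ler_wpM2l// [leRHS]exprS ler_peMl// ltW.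
  rewrite -(ler_pM2l t0).
  have -> : tau * (2 * tau * (M * N ^+ 2)) = M / 2 * (2 * tau * N) ^+ 2 by field.
  have M2 : 0 <= M / 2 by rewrite divr_ge0.
  apply: (le_trans (ler_wpM2l M2 sq)).
  have MT : M / 2 * (3 * T ^+ 2) <= tau / 4 * T ^+ 2.
    by rewrite mulrA ler_wpM2r ?sqr_ge0//; lra.
  have MB : M / 2 * 3 * (tau ^+ 2 * B * v ^+ 2 + q ^+ 2 * v' ^+ 2) <=
      M / 2 * 3 * (r * tau ^+ 4 * v ^+ 2 + r * tau ^+ 4 * v' ^+ 2).
    by rewrite ler_wpM2l ?mulr_ge0//; lra.
  have -> : tau * (4^-1 * T ^+ 2 + 3 / 2 * M * (r * (tau ^+ 3 * v ^+ 2) + r * (tau ^+ 3 * v' ^+ 2)))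
     = tau / 4 * T ^+ 2 + M / 2 * 3 * (r * tau ^+ 4 * v ^+ 2 + r * tau ^+ 4 * v' ^+ 2) by field.
  lra.
have eE : - (c / 4 * (tau * G) + c^-1 * (r * (tau ^+ 3 * v ^+ 2))) <= tau * v * e.
  (* The square completed below divides by [B]. *)
  have [B00|Bn0] := eqVneq B 0.
    have -> : e = 0.
      by apply/eqP; rewrite -sqrf_eq0 eq_le sqr_ge0 andbT (le_trans He)// B00 mul0r.
    rewrite mulr0 oppr_le0; have ic0 : 0 <= c^-1 by rewrite invr_ge0 ltW.
    have := mulr_ge0 ic0 (mulr_ge0 r0 (mulr_ge0 (ltW t3) v2)).
    have := mulr_ge0 (ltW c0) (mulr_ge0 (ltW t0) G0); lra.
  have Bp : 0 < B by rewrite lt_neqAle eq_sym Bn0.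
  have GB : c / 4 * (tau * (e ^+ 2 / B)) <= c / 4 * (tau * G).
    by rewrite ler_pM2l ?divr_gt0// ler_pM2l// ler_pdivrMr// mulrC.
  have vB : c^-1 * (tau * B * v ^+ 2) <= c^-1 * (r * (tau ^+ 3 * v ^+ 2)).
    by rewrite ler_pM2l ?invr_gt0// mulrA ler_wpM2r.
  have : 0 <= tau * c / (4 * B) * (e + 2 * B / c * v) ^+ 2.
    by rewrite mulr_ge0 ?sqr_ge0// divr_ge0 ?mulr_ge0 ?(ltW c0) ?(ltW t0).
  have -> : tau * c / (4 * B) * (e + 2 * B / c * v) ^+ 2 =
     c / 4 * (tau * (e ^+ 2 / B)) + tau * v * e + c^-1 * (tau * B * v ^+ 2).
    by field; rewrite !gt_eqF.
  lra.
have sE : - (r * (tau ^+ 3 * v ^+ 2)) <= tau * s * v ^+ 2.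
  rewrite (_ : - _ = tau * (- (r * tau ^+ 2)) * v ^+ 2); last by ring.
  by rewrite ler_wpM2r// ler_pM2l.
have kE : - (4^-1 * T ^+ 2 + r * (tau ^+ 3 * v ^+ 2)) <= tau * k * v * T.
  have kB : (tau * k * v) ^+ 2 <= r * (tau ^+ 3 * v ^+ 2).
    rewrite !exprMn [leRHS]mulrA; apply: (@le_trans _ _ (tau ^+ 2 * B * v ^+ 2)).
      by rewrite ler_wpM2r// ler_pM2l.
    by rewrite ler_wpM2r.
  have := sqr_ge0 (2^-1 * T + tau * k * v).
  move: (tau * k * v) kB => a kB; rewrite sqrrD exprMn; lra.
have HT : 2 * tau * (c * G) - 2 * tau * (M * N ^+ 2) <= 2 * tau * hv.
  by rewrite -mulrBr; apply: ler_wpM2l => //; rewrite mulr_ge0// ltW.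
have QT : 2 * c * (tau ^+ 3 * v ^+ 2) <= 2 * tau ^+ 3 * Q * v ^+ 2.
  rewrite (_ : 2 * tau ^+ 3 * Q * v ^+ 2 = 2 * Q * (tau ^+ 3 * v ^+ 2)); last by ring.
  by apply: ler_wpM2r; [rewrite mulr_ge0// ltW|rewrite ler_pM2l].
have A0 : 0 <= tau ^+ 3 * v ^+ 2 by rewrite mulr_ge0// ltW.
have A'0 : 0 <= tau ^+ 3 * v' ^+ 2 by rewrite mulr_ge0// ltW.
(* The errors in [tau^3 v^2] are [3/2 M r] from [NE], [c^-1 r] from [eE] and [r] from each of [sE]
   and [kE]. Their sum is at most [c / 4], which lowers [2 c] to [7/4 c]. *)
have rA := ler_wpM2r A0 Hr.
have M2 : 3 / 2 * M * r <= c / 4.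
  apply: le_trans Hr; rewrite ler_wpM2r//; have : 0 < c^-1 by rewrite invr_gt0.
  lra.
have rA' := ler_wpM2r A'0 M2.
move: (tau ^+ 3 * v ^+ 2) (tau ^+ 3 * v' ^+ 2) NE eE sE kE QT rA rA' {A0 A'0} => A A'.
rewrite !mulrDl.
move: c^-1 => ic; lra.
Qed.

End carleman.

(** * The Carleman identity and the pointwise estimate *)

Section carleman_pointwise.
Context {R : realType} {d : nat}.
Local Notation E := 'rV[R]_d.
Implicit Types (phi kappa p q v w : E -> R) (x : E).

(** The first two lines come from [- laplacian v] times [2 tau gdot phi v], the third from
    [- laplacian v] times [tau (laplacian phi) v], the fourth from the potential part of
    [carleman_S] times the first-order part, the last from [- laplacian v] times [tau kappa v]. *)
Definition carleman_flux phi kappa p tau v x : R :=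
  tau * divergence (gdot v v) phi x
  - 2 * tau * divergence (gdot phi v) v x
  - tau * divergence (fun y => laplacian phi y * v y) v x
  - tau * divergence
      (fun y => (tau ^+ 2 * gdot phi phi y + p y) * (v y * v y)) phi x
  - tau * divergence (fun y => kappa y * v y) v x.

(* [carleman_S + carleman_T] is minus [e^(tau phi) (Delta + p) (e^(-tau phi) v) + q w],
   split into its symmetric part and a first order multiplier. *)
Definition carleman_S phi p tau v x : R :=
  - laplacian v x - (tau ^+ 2 * gdot phi phi x + p x) * v x.

Definition carleman_T phi q tau v w x : R :=
  2 * tau * gdot phi v x + tau * laplacian phi x * v x - q x * w x.

(** The extra multiplier [tau kappa v] transfers positivity between orders: [kappa / 2] is added to
    the Hessian on [grad v], and [kappa / 2 |grad phi|^2] is taken from the coefficient of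
    [v ^+ 2]. *)
Definition carleman_form phi kappa p tau v T x : R :=
  T ^+ 2
  + 2 * tau * (hess phi (grad v x) (grad v x) x + 2^-1 * kappa x * gdot v v x)
  + 2 * tau ^+ 3 * (hess phi (grad phi x) (grad phi x) x
      - 2^-1 * kappa x * gdot phi phi x) * v x ^+ 2
  + tau * v x * (gdot (laplacian phi) v x + gdot kappa v x)
  + tau * (gdot p phi x - kappa x * p x) * v x ^+ 2
  + tau * kappa x * v x * T.

(** The coupling enters the two multipliers as [- q w] and [q v]. Against the potentials of
    [carleman_S] these cancel pointwise; against the Laplacians they give two divergences and terms
    in [grad q], as [q grad v . grad w] cancels too. *)
Lemma carleman_identity phi kappa p q tau v w x :
  Cinf phi -> Cinf kappa -> Cinf p -> Cinf q -> Cinf v -> Cinf w ->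
  let T1 := carleman_T phi q tau v w x in
  let T2 := carleman_T phi (fun y => - q y) tau w v x in
  (carleman_S phi p tau v x + T1) * (T1 + tau * kappa x * v x) +
  (carleman_S phi p tau w x + T2) * (T2 + tau * kappa x * w x) =
  carleman_form phi kappa p tau v T1 x + carleman_form phi kappa p tau w T2 x
  - (w x * gdot q v x - v x * gdot q w x)
  + (carleman_flux phi kappa p tau v x + carleman_flux phi kappa p tau w x
     + divergence (fun y => q y * w y) v x - divergence (fun y => q y * v y) w x).
Proof.
move=> Cphi Ck Cp Cq Cv Cw.
have fluxE u : Cinf u -> carleman_flux phi kappa p tau u x =
   - 2 * tau * gdot phi u x * laplacian u x
   - 2 * tau * hess phi (grad u x) (grad u x) x
   - tau * laplacian phi x * u x * laplacian u x
   - tau * u x * gdot (laplacian phi) u x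
   - tau * (tau ^+ 2 * gdot phi phi x + p x) * u x ^+ 2 * laplacian phi x
   - tau * ((tau ^+ 2 * gdot phi phi x + p x) * (2 * u x * gdot phi u x)
      + u x ^+ 2 * (2 * tau ^+ 2 * hess phi (grad phi x) (grad phi x) x + gdot p phi x))
   - tau * (kappa x * u x * laplacian u x + kappa x * gdot u u x + u x * gdot kappa u x).
  move=> Cu.
  have CL := Cinf_laplacian Cphi; have CF := Cinf_gdot Cphi Cphi.
  have Cc : Cinf (fun _ : E => tau ^+ 2) by exact: Cinf_cst.
  have Ch : Cinf (fun y => tau ^+ 2 * gdot phi phi y + p y).
    by apply: CinfD => //; exact: CinfM.
  rewrite /carleman_flux /divergence gdot_gdot// !gdotMl//; last exact: CinfM.
  rewrite gdotDl ?gdotZl//; last exact: CinfM.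
  rewrite [gdot (gdot phi phi) phi x]gdotC gdot_gdot_self//.
  rewrite [gdot (gdot u u) phi x]gdotC [gdot u phi x]gdotC.
  move: (gdot phi (gdot u u) x) (hess _ _ _ _) (hess _ _ _ _) => a1 a2 a3.
  move: (gdot (laplacian phi) u x) (gdot phi phi x) (gdot phi u x) (gdot p phi x) => a4 a5 a6 a7.
  move: (gdot u u x) (gdot kappa u x) (laplacian u x) (laplacian phi x) => a8 a9 a10 a11.
  move: (u x) (kappa x) (p x) => b1 b2 b3; by field.
rewrite !fluxE// /divergence !gdotMl// [gdot w v x]gdotC.
rewrite /carleman_form /carleman_S /carleman_T.
move: (hess _ _ _ _) (hess _ _ _ _) (hess _ _ _ _) => h1 h2 h3.
move: (gdot (laplacian phi) v x) (gdot (laplacian phi) w x) => a1 a2.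
move: (gdot phi phi x) (gdot phi v x) (gdot phi w x) (gdot p phi x) => a3 a4 a5 a6.
move: (gdot v v x) (gdot w w x) (gdot v w x) => a7 a8 a9.
move: (gdot kappa v x) (gdot kappa w x) (gdot q v x) (gdot q w x) => c1 c2 c3 c4.
move: (laplacian v x) (laplacian w x) (laplacian phi x) => l1 l2 l3.
move: (v x) (w x) (kappa x) (p x) (q x) => b1 b2 b3 b4 b5; by field.
Qed.

(** By Lagrange's identity the defect is half the sum of the squared 2 by 2 minors. *)
Lemma dot_cauchy_schwarz (z w : E) : dot z w ^+ 2 <= dot z z * dot w w.
Proof.
have S2 (a b : E) : \sum_j \sum_k a ord0 j * b ord0 k =
    (\sum_j a ord0 j) * (\sum_k b ord0 k).
  by rewrite mulr_suml; apply: eq_bigr => j _; rewrite mulr_sumr.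
have sq : 0 <= \sum_j \sum_k (z ord0 j * w ord0 k - z ord0 k * w ord0 j) ^+ 2.
  by apply: sumr_ge0 => j _; apply: sumr_ge0 => k _; exact: sqr_ge0.
have -> : dot z z * dot w w = dot z w ^+ 2 +
    2^-1 * \sum_j \sum_k (z ord0 j * w ord0 k - z ord0 k * w ord0 j) ^+ 2.
  pose a := \row_j (z ord0 j ^+ 2); pose b := \row_j (w ord0 j ^+ 2).
  pose m := \row_j (z ord0 j * w ord0 j).
  have -> : \sum_j \sum_k (z ord0 j * w ord0 k - z ord0 k * w ord0 j) ^+ 2 =
     \sum_j \sum_k a ord0 j * b ord0 k + \sum_j \sum_k b ord0 j * a ord0 k
     - 2 * \sum_j \sum_k m ord0 j * m ord0 k.
    rewrite mulr_sumr -sumrN -!big_split; apply: eq_bigr => j _ /=.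
    rewrite mulr_sumr -sumrN -!big_split; apply: eq_bigr => k _ /=.
    rewrite !mxE; move: (z _ _) (z _ _) (w _ _) (w _ _) => z1 z2 w1 w2; ring.
  rewrite !S2.
  have -> : \sum_j a ord0 j = dot z z by apply: eq_bigr => j _; rewrite mxE expr2.
  have -> : \sum_j b ord0 j = dot w w by apply: eq_bigr => j _; rewrite mxE expr2.
  have -> : \sum_j m ord0 j = dot z w by apply: eq_bigr => j _; rewrite mxE.
  by move: (dot _ _) (dot _ _) (dot _ _) => a1 a2 a3; field.
by rewrite lerDl mulr_ge0// invr_ge0.
Qed.

Lemma gdot_cauchy_schwarz phi p x :
  gdot phi p x ^+ 2 <= gdot phi phi x * gdot p p x.
Proof. by rewrite !gdotE; exact: dot_cauchy_schwarz. Qed.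

Lemma gdot_ge0 p x : 0 <= gdot p p x.
Proof. by rewrite gdotE dot_ge0. Qed.

Lemma ler_pnorm_sqr (a b : R) : a ^+ 2 <= b ^+ 2 -> 0 <= b -> a <= b.
Proof.
move=> ab b0; rewrite (le_trans (ler_norm a))// -(ler_pXn2r (n := 2)) ?nnegrE//.
by rewrite real_normK ?num_real.
Qed.

Lemma carleman_pointwise (c M B r : R) phi kappa p q tau v w x :
  Cinf phi -> Cinf kappa -> Cinf p -> Cinf q -> Cinf v -> Cinf w ->
  0 < c -> 0 <= M -> 1 <= tau -> 0 <= B ->
  (forall z, c * dot z z - M * dot (grad phi x) z ^+ 2 <=
             hess phi z z x + 2^-1 * kappa x * dot z z) ->
  c <= hess phi (grad phi x) (grad phi x) x - 2^-1 * kappa x * gdot phi phi x ->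
  2 * (gdot (laplacian phi) (laplacian phi) x + gdot kappa kappa x) <= B ->
  laplacian phi x ^+ 2 <= B -> kappa x ^+ 2 <= B -> B <= r * tau ->
  q x ^+ 2 <= r * tau ^+ 4 ->
  - (r * tau ^+ 2) <= gdot p phi x - kappa x * p x ->
  gdot q q x <= c ^+ 2 / 8 * tau ^+ 4 ->
  6 * M <= tau -> (3 / 2 * M + c^-1 + 2) * r <= c / 4 ->
  forall H1 H2,
  H1 = carleman_S phi p tau v x + carleman_T phi q tau v w x ->
  H2 = carleman_S phi p tau w x + carleman_T phi (fun y => - q y) tau w v x ->
  c / 2 * (tau * (gdot v v x + gdot w w x) + tau ^+ 3 * (v x ^+ 2 + w x ^+ 2)) <=
  H1 ^+ 2 + H2 ^+ 2
  - (carleman_flux phi kappa p tau v x + carleman_flux phi kappa p tau w x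
     + divergence (fun y => q y * w y) v x - divergence (fun y => q y * v y) w x).
Proof.
move=> Cphi Ck Cp Cq Cv Cw c0 M0 t1 B0 conv HQ HdL HL Hk HB Hq Hs Hdq HM Hr H1 H2 H1E H2E.
have := carleman_identity tau x Cphi Ck Cp Cq Cv Cw.
set T1 := carleman_T phi q tau v w x.
set T2 := carleman_T phi (fun y => - q y) tau w v x.
rewrite /= -/T1 -/T2 -H1E -H2E.
set flux := _ + _ + _ - divergence _ _ _.
have t0 : 0 < tau by lra.
have He u : (gdot (laplacian phi) u x + gdot kappa u x) ^+ 2 <= B * gdot u u x.
  apply: (@le_trans _ _ (2 * (gdot (laplacian phi) (laplacian phi) x
    + gdot kappa kappa x) * gdot u u x)); last by rewrite ler_wpM2r// gdot_ge0.
  have := gdot_cauchy_schwarz (laplacian phi) u x.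
  have := gdot_cauchy_schwarz kappa u x.
  move: (gdot (laplacian phi) u x) (gdot kappa u x) => a b hb ha.
  have := sqr_ge0 (a - b); rewrite sqrrB sqrrD -mulrA !mulrDl mulrDr; lra.
have conv' u : c * gdot u u x - M * gdot phi u x ^+ 2 <=
    hess phi (grad u x) (grad u x) x + 2^-1 * kappa x * gdot u u x.
  by rewrite !gdotE; exact: conv.
have HN1 : 2 * tau * gdot phi v x = T1 - tau * laplacian phi x * v x + q x * w x.
  by rewrite /T1 /carleman_T; move: (gdot _ _ _) (laplacian _ _) => a b; ring.
have HN2 : 2 * tau * gdot phi w x = T2 - tau * laplacian phi x * w x + (- q x) * v x.
  by rewrite /T2 /carleman_T; move: (gdot _ _ _) (laplacian _ _) => a b; ring.
have L1 := component_lower c0 M0 t1 (gdot_ge0 v x) B0 (conv' v) HQ HN1 (He v) HL Hk HB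
  Hq Hs HM Hr.
have Hq' : (- q x) ^+ 2 <= r * tau ^+ 4 by rewrite sqrrN.
have L2 := component_lower c0 M0 t1 (gdot_ge0 w x) B0 (conv' w) HQ HN2 (He w) HL Hk HB
  Hq' Hs HM Hr.
rewrite -/(carleman_form phi kappa p tau v T1 x) in L1.
rewrite -/(carleman_form phi kappa p tau w T2 x) in L2.
(* With [|grad q|] at most of order [tau^2], the coupling is of the size of the geometric mean of
   [tau |grad v|^2] and [tau^3 v^2]; the comparison is made between squares. *)
have coupling : w x * gdot q v x - v x * gdot q w x <=
    c / 4 * (tau * (gdot v v x + gdot w w x) + tau ^+ 3 * (v x ^+ 2 + w x ^+ 2)).
  have := gdot_cauchy_schwarz q v x; have := gdot_cauchy_schwarz q w x.
  move: (gdot_ge0 v x) (gdot_ge0 w x) Hdq.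
  move: (gdot q v x) (gdot q w x) (gdot v v x) (gdot w w x) (gdot q q x) (v x) (w x).
  move=> a b G1 G2 Q v0 w0 G10 G20 HdQ hb ha.
  have vw0 : 0 <= v0 ^+ 2 + w0 ^+ 2 by rewrite addr_ge0 ?sqr_ge0.
  have t3 : 0 < tau ^+ 3 by rewrite exprn_gt0.
  apply: ler_pnorm_sqr; last first.
    have A1 := mulr_ge0 (ltW t0) (addr_ge0 G10 G20).
    have A2 := mulr_ge0 (ltW t3) vw0.
    by rewrite mulr_ge0 ?(addr_ge0 A1 A2)// divr_ge0// ltW.
  apply: (@le_trans _ _ (2 * Q * ((v0 ^+ 2 + w0 ^+ 2) * (G1 + G2)))).
    apply: (@le_trans _ _ (2 * (w0 ^+ 2 * a ^+ 2 + v0 ^+ 2 * b ^+ 2))).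
      rewrite -subr_ge0 (_ : _ - _ = (w0 * a + v0 * b) ^+ 2) ?sqr_ge0//; ring.
    have := ler_wpM2l (sqr_ge0 w0) ha; have := ler_wpM2l (sqr_ge0 v0) hb.
    have Q0 : 0 <= Q * G1 by exact: le_trans (sqr_ge0 a) ha.
    have Q0' : 0 <= Q * G2 by exact: le_trans (sqr_ge0 b) hb.
    have := mulr_ge0 (sqr_ge0 v0) Q0; have := mulr_ge0 (sqr_ge0 w0) Q0'.
    lra.
  apply: (@le_trans _ _ (2 * (c ^+ 2 / 8 * tau ^+ 4) * ((v0 ^+ 2 + w0 ^+ 2) * (G1 + G2)))).
    by rewrite ler_wpM2r ?mulr_ge0 ?addr_ge0 ?sqr_ge0// ler_pM2l.
  rewrite -subr_ge0 (_ : _ - _ = (c / 4 * (tau * (G1 + G2) - tau ^+ 3 * (v0 ^+ 2 + w0 ^+ 2))) ^+ 2).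
    exact: sqr_ge0.
  by field.
move=> idt.
(* The [2^-1 * T ^+ 2] spent here is exactly the one that [component_lower] retains. *)
have kH k u H T : k ^+ 2 <= B ->
    H * (T + tau * k * u) <= 2^-1 * T ^+ 2 + H ^+ 2 + c / 4 * (tau ^+ 3 * u ^+ 2).
  move=> kB.
  have rc : r <= c / 4.
    apply: le_trans Hr; rewrite ler_peMl//.
      by rewrite -(pmulr_lge0 _ t0); exact: le_trans HB.
    have : 0 < c^-1 by rewrite invr_gt0.
    lra.
  have tk : (tau * k * u) ^+ 2 <= c / 4 * (tau ^+ 3 * u ^+ 2).
    rewrite !exprMn [leRHS]mulrA; apply: ler_wpM2r; first exact: sqr_ge0.
    apply: (@le_trans _ _ (tau ^+ 2 * (r * tau))).
      by rewrite ler_pM2l ?exprn_gt0//; exact: le_trans HB.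
    rewrite (_ : tau ^+ 2 * (r * tau) = r * tau ^+ 3); last by ring.
    by rewrite ler_pM2r ?exprn_gt0.
  have := sqr_ge0 (T - H); have := sqr_ge0 (H - tau * k * u).
  have := sqr_ge0 (tau * k * u).
  move: (tau * k * u) tk => a; rewrite !sqrrB mulrDr; lra.
have pos1 u : 0 <= c * (tau * gdot u u x).
  by rewrite mulr_ge0 ?(ltW c0)// mulr_ge0 ?gdot_ge0// ltW.
have pos2 u : 0 <= c * (tau ^+ 3 * u x ^+ 2).
  by rewrite mulr_ge0 ?(ltW c0)// mulr_ge0 ?sqr_ge0// exprn_ge0// ltW.
have := pos1 v; have := pos1 w; have := pos2 v; have := pos2 w.
have := kH _ (v x) H1 T1 Hk; have := kH _ (w x) H2 T2 Hk.
move: idt L1 L2 coupling.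
move: (carleman_form _ _ _ _ _ _ _) (carleman_form _ _ _ _ _ _ _) flux => F1 F2 flux.
move: (H1 * _) (H2 * _) (_ * gdot q v x - _) => P1 P2 W.
move: (gdot v v x) (gdot w w x) (tau ^+ 3) => G1 G2 t3.
lra.
Qed.

End carleman_pointwise.

(** * The potential, the conjugation by the weight and the substitution *)

Section damping.
Context {R : realType} {d : nat}.
Local Notation E := 'rV[R]_d.
Implicit Types (phi a f h v w : E -> R) (x : E).

(* Real part and minus the imaginary part of [lambda^2 / (1 + i lambda a)]. *)
Definition damping_re a lambda x : R := lambda ^+ 2 / (1 + (lambda * a x) ^+ 2).

Definition damping_im a lambda x : R := lambda * a x * damping_re a lambda x.

Lemma damping_den_gt0 a lambda x : 0 < 1 + (lambda * a x) ^+ 2 :> R.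
Proof. by rewrite ltr_pwDl// sqr_ge0. Qed.

Lemma Cinf_damping_den a lambda : Cinf a ->
  Cinf (fun x => 1 + (lambda * a x) * (lambda * a x)).
Proof.
move=> Ca; have Cc (c : R) : Cinf (fun _ : E => c) by exact: Cinf_cst.
by apply: CinfD => //; do 2 apply: CinfM => //.
Qed.

Lemma Cinf_damping_re a lambda : Cinf a -> Cinf (damping_re a lambda).
Proof.
move=> Ca; apply: CinfM; first exact: Cinf_cst.
apply: Cinf_inv => [x|]; first by rewrite gt_eqF// damping_den_gt0.
by have := Cinf_damping_den lambda Ca; under eq_fun do rewrite -expr2.
Qed.

Lemma Cinf_damping_im a lambda : Cinf a -> Cinf (damping_im a lambda).
Proof.
move=> Ca; apply: CinfM; last exact: Cinf_damping_re.
by apply: CinfM => //; exact: Cinf_cst.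
Qed.

(** Obtained by differentiating the constant product [(1 + s^2) * damping_re = lambda^2], where
    [s = lambda a]. *)
Lemma gdot_damping_re a lambda h x : Cinf a ->
  gdot (damping_re a lambda) h x =
  - (2 * lambda ^+ 3 * (lambda * a x) / (1 + (lambda * a x) ^+ 2) ^+ 2) * gdot a h x.
Proof.
move=> Ca; have D0 := damping_den_gt0 a lambda x.
have Cp := Cinf_damping_re lambda Ca; have Cd := Cinf_damping_den lambda Ca.
have Cs : Cinf (fun y => lambda * a y) by apply: CinfM => //; exact: Cinf_cst.
have E0 : gdot (fun y => (1 + (lambda * a y) * (lambda * a y)) * damping_re a lambda y) h x = 0.
  rewrite (_ : (fun y => _) = fun=> lambda ^+ 2); last first.
    apply/funext => y; rewrite /damping_re -expr2 mulrC divfK// gt_eqF//.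
    exact: damping_den_gt0.
  by rewrite /gdot big1// => j _; rewrite partial_cst mul0r.
move: E0; rewrite gdotMl// gdotDl//; [|exact: Cinf_cst|exact: CinfM].
rewrite gdotMl// gdotZl// {2}/damping_re -expr2.
have -> : gdot (fun=> 1) h x = 0 by rewrite /gdot big1// => j _; rewrite partial_cst mul0r.
move: (gdot (damping_re a lambda) h x) (gdot a h x) => P b E0.
apply: (@mulfI _ (1 + (lambda * a x) ^+ 2)); first by rewrite gt_eqF.
rewrite -[LHS]addr0 -[X in _ + X]oppr0 -[in X in _ - X]E0.
by field; rewrite gt_eqF.
Qed.

Lemma gdot_damping_im a lambda h x : Cinf a ->
  gdot (damping_im a lambda) h x =
  lambda ^+ 3 * (1 - (lambda * a x) ^+ 2) / (1 + (lambda * a x) ^+ 2) ^+ 2 * gdot a h x.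
Proof.
move=> Ca; have D0 := damping_den_gt0 a lambda x.
have Cp := Cinf_damping_re lambda Ca.
have Cs : Cinf (fun y => lambda * a y) by apply: CinfM => //; exact: Cinf_cst.
rewrite [LHS]gdotMl// gdotZl// gdot_damping_re// /damping_re.
by move: (gdot a h x) => b; field; rewrite gt_eqF.
Qed.

Lemma partial_weight phi tau j : Cinf phi ->
  partial j (fun y => expR (tau * phi y)) =
  fun x => tau * (expR (tau * phi x) * partial j phi x).
Proof.
move=> Cphi; apply/funext => x; have Cj := @Cinf_derivable _ _ phi Cphi j.
have Ct : Cinf (fun y => tau * phi y) by apply: CinfM => //; exact: Cinf_cst.
rewrite /partial derive_expR_comp; last exact: Cinf_derivable.
by rewrite -/(partial j _ x) partialZ// mulrCA.
Qed.

Lemma Cinf_weight phi tau : Cinf phi -> Cinf (fun y => expR (tau * phi y)).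
Proof. by move=> Cphi; apply/Cinf_expR/CinfM => //; exact: Cinf_cst. Qed.

Lemma gdot_weight phi tau h x : Cinf phi ->
  gdot (fun y => expR (tau * phi y)) h x = tau * expR (tau * phi x) * gdot phi h x.
Proof.
move=> Cphi; rewrite /gdot mulr_sumr; apply: eq_bigr => j _.
by rewrite partial_weight// !mulrA.
Qed.

Lemma laplacian_weight phi tau x : Cinf phi ->
  laplacian (fun y => expR (tau * phi y)) x =
  expR (tau * phi x) * (tau * laplacian phi x + tau ^+ 2 * gdot phi phi x).
Proof.
move=> Cphi; rewrite /laplacian /gdot !mulr_sumr -big_split mulr_sumr.
apply: eq_bigr => j _ /=; rewrite partial_weight//.
have Ce := Cinf_weight tau Cphi; have Cj := Cinf_partial j Cphi.
rewrite partialZ; last exact: (Cinf_derivable (CinfM Ce Cj)).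
rewrite partialM; [|exact: Cinf_derivable|exact: Cinf_derivable].
rewrite partial_weight//.
move: (expR _) (partial j (partial j phi) x) (partial j phi x) => b1 b2 b3; ring.
Qed.

Lemma conjugated_gdot phi tau w h x : Cinf phi -> Cinf w ->
  gdot (fun y => expR (tau * phi y) * w y) h x =
  expR (tau * phi x) * (gdot w h x + tau * w x * gdot phi h x).
Proof.
move=> Cphi Cw; rewrite gdotMl//; last exact: Cinf_weight.
rewrite gdot_weight//; move: (gdot w h x) (gdot phi h x) => a b; ring.
Qed.

Lemma conjugated_laplacian phi tau w x : Cinf phi -> Cinf w ->
  laplacian (fun y => expR (tau * phi y) * w y) x =
  expR (tau * phi x) * (laplacian w x + 2 * tau * gdot phi w x +
    (tau * laplacian phi x + tau ^+ 2 * gdot phi phi x) * w x).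
Proof.
move=> Cphi Cw; have Ce := Cinf_weight tau Cphi.
rewrite laplacianM// gdot_weight// laplacian_weight//.
move: (laplacian w x) (laplacian phi x) (gdot phi w x) (gdot phi phi x) => b1 b2 b3 b4.
ring.
Qed.

Lemma carleman_conjugation phi p q tau w w' x : Cinf phi -> Cinf w ->
  carleman_S phi p tau (fun y => expR (tau * phi y) * w y) x +
  carleman_T phi q tau (fun y => expR (tau * phi y) * w y)
    (fun y => expR (tau * phi y) * w' y) x =
  - expR (tau * phi x) * (laplacian w x + p x * w x + q x * w' x).
Proof.
move=> Cphi Cw; rewrite /carleman_S /carleman_T conjugated_laplacian//.
rewrite [gdot phi (fun y => _ * _) x]gdotC conjugated_gdot// [gdot w phi x]gdotC.
move: (laplacian w x) (laplacian phi x) (gdot phi w x) (gdot phi phi x) => b1 b2 b3 b4.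
ring.
Qed.

Lemma laplacian_damped a lambda u1 u2 x : Cinf a -> Cinf u1 -> Cinf u2 ->
  laplacian (fun y => u1 y + lambda * a y * u2 y) x =
  laplacian u1 x + lambda * (a x * laplacian u2 x + 2 * gdot a u2 x + u2 x * laplacian a x).
Proof.
move=> Ca C1 C2; have Cs : Cinf (fun y => lambda * a y).
  by apply: CinfM => //; exact: Cinf_cst.
rewrite laplacianD//; last exact: CinfM.
rewrite laplacianM// gdotZl// laplacianZ//.
move: (laplacian u1 x) (laplacian u2 x) (gdot a u2 x) (laplacian a x) => b1 b2 b3 b4.
ring.
Qed.

(* With [c = - lambda] on [(Re u, Im u)] and [c = lambda] on [(Im u, Re u)], these are
   the real and imaginary parts of [e^(tau phi) (1 + i lambda a) u]. *)
Definition damped phi a (tau c : R) (w w' : E -> R) (y : E) : R :=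
  expR (tau * phi y) * (w y + c * a y * w' y).

Lemma Cinf_damped phi a tau c w w' : Cinf phi -> Cinf a -> Cinf w -> Cinf w' ->
  Cinf (damped phi a tau c w w').
Proof.
move=> Cphi Ca Cw Cw'; apply: CinfM; first exact: Cinf_weight.
by apply: CinfD => //; apply: CinfM => //; apply: CinfM => //; exact: Cinf_cst.
Qed.

Lemma partial_damped phi a tau c w w' j x :
  Cinf phi -> Cinf a -> Cinf w -> Cinf w' ->
  partial j (damped phi a tau c w w') x =
  expR (tau * phi x) *
    (partial j w x + c * a x * partial j w' x + c * partial j a x * w' x)
  + tau * partial j phi x * damped phi a tau c w w' x.
Proof.
move=> Cphi Ca Cw Cw'; have Dj f : Cinf f -> derivable f x (delta_mx ord0 j).
  by move=> Cf; exact: Cinf_derivable.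
have Cs : Cinf (fun y => c * a y) by apply: CinfM => //; exact: Cinf_cst.
have Caw : Cinf (fun y => c * a y * w' y) by exact: CinfM.
rewrite /damped partialM; [|exact/Dj/Cinf_weight|exact/Dj/CinfD].
rewrite partialD; [|exact: Dj|exact: Dj].
rewrite partialM; [|exact: Dj|exact: Dj].
rewrite partialZ; last exact: Dj.
rewrite partial_weight//.
move: (partial j w x) (partial j w' x) (partial j a x) (partial j phi x) => b1 b2 b3 b4.
ring.
Qed.

(** Real and imaginary parts of [(lambda^2 / A) (A z) = lambda^2 z] for [z = b + i c] and
    [A = 1 + i lambda a]. *)
Lemma damping_reE a lambda (b c : R) x :
  damping_re a lambda x * (b + - lambda * a x * c)
  + damping_im a lambda x * (c + lambda * a x * b) = lambda ^+ 2 * b /\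
  damping_re a lambda x * (c + lambda * a x * b)
  + - damping_im a lambda x * (b + - lambda * a x * c) = lambda ^+ 2 * c.
Proof.
rewrite /damping_im /damping_re; have D0 := damping_den_gt0 a lambda x.
by move: (a x) D0 => s D0; split; field; rewrite gt_eqF.
Qed.

(** The remainder is the difference between [Delta (A u)] and [div (A grad u)], the latter being the
    second-order part of [- P u]. *)
Lemma conjugated_damped phi a tau lambda u1 u2 x :
  Cinf phi -> Cinf a -> Cinf u1 -> Cinf u2 ->
  forall v1 v2, v1 = damped phi a tau (- lambda) u1 u2 ->
  v2 = damped phi a tau lambda u2 u1 ->
  let p := damping_re a lambda in let q := damping_im a lambda in
  (carleman_S phi p tau v1 x + carleman_T phi q tau v1 v2 x =
   expR (tau * phi x) * ((- laplacian u1 x + lambda * divergence a u2 x - lambda ^+ 2 * u1 x)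
      + lambda * (gdot a u2 x + u2 x * laplacian a x))) /\
  (carleman_S phi p tau v2 x + carleman_T phi (fun y => - q y) tau v2 v1 x =
   expR (tau * phi x) * ((- laplacian u2 x - lambda * divergence a u1 x - lambda ^+ 2 * u2 x)
      - lambda * (gdot a u1 x + u1 x * laplacian a x))).
Proof.
move=> Cphi Ca C1 C2 v1 v2 -> -> p q.
have Cw c f g : Cinf f -> Cinf g -> Cinf (fun y => f y + c * a y * g y).
  move=> Cf Cg; apply: CinfD => //; apply: CinfM => //; apply: CinfM => //.
  exact: Cinf_cst.
have [E1 E2] := damping_reE a lambda (u1 x) (u2 x) x.
split.
  apply: (etrans (carleman_conjugation p q tau (fun y => u2 y + lambda * a y * u1 y) x
     Cphi (Cw (- lambda) _ _ C1 C2))).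
  rewrite laplacian_damped// -addrA E1 /divergence.
  move: (laplacian u1 x) (laplacian u2 x) (gdot a u2 x) (laplacian a x).
  by move=> b1 b2 b3 b4; ring.
apply: (etrans (carleman_conjugation p (fun y => - q y) tau
  (fun y => u1 y + - lambda * a y * u2 y) x Cphi (Cw lambda _ _ C2 C1))).
rewrite laplacian_damped// -addrA E2 /divergence.
move: (laplacian u1 x) (laplacian u2 x) (gdot a u1 x) (laplacian a x).
by move=> b1 b2 b3 b4; ring.
Qed.

Lemma complex_sum (I : Type) (r : seq I) (F G : I -> R) :
  (\sum_(i <- r) (F i +i* G i) = (\sum_(i <- r) F i) +i* (\sum_(i <- r) G i))%C.
Proof.
elim: r => [|i r IH]; first by rewrite !big_nil.
by rewrite !big_cons IH; apply/eqP; rewrite eq_complex /= !eqxx.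
Qed.

Lemma DopE (j : 'I_d) (w : E -> R[i]) y : Dop j w y =
  (partial j (fun z => complex.Im (w z)) y +i* - partial j (fun z => complex.Re (w z)) y)%C.
Proof.
by rewrite /Dop; apply/eqP; rewrite eq_complex /=; apply/andP; split; apply/eqP; ring.
Qed.

Lemma Re_Pop a lambda (u : E -> R[i]) x :
  csmooth u -> Cinf a ->
  complex.Re (Pop a lambda u x) =
    - laplacian (fun y => complex.Re (u y)) x
    + lambda * divergence a (fun y => complex.Im (u y)) x
    - lambda ^+ 2 * complex.Re (u x) /\
  complex.Im (Pop a lambda u x) =
    - laplacian (fun y => complex.Im (u y)) x
    - lambda * divergence a (fun y => complex.Re (u y)) x
    - lambda ^+ 2 * complex.Im (u x).
Proof.
move=> [/smooth_Cinf C1 /smooth_Cinf C2] Ca.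
have PopE : Pop a lambda u x =
  ((- laplacian (fun y => complex.Re (u y)) x +i*
    - laplacian (fun y => complex.Im (u y)) x)
   + 'i * lambda%:C * (- divergence a (fun y => complex.Re (u y)) x +i*
                       - divergence a (fun y => complex.Im (u y)) x)
   - (lambda ^+ 2)%:C * u x)%C.
  rewrite /Pop; congr (_ + _ * _ - _).
    under eq_bigr do rewrite DopE.
    rewrite complex_sum; congr (_ +i* _)%C; rewrite /laplacian -sumrN;
      apply: eq_bigr => j _.
      under eq_fun do rewrite DopE /=.
      by rewrite partialN//; apply/Cinf_derivable/Cinf_partial.
    congr (- _); under eq_fun do rewrite DopE /=.
    by [].
  under eq_bigr do rewrite DopE.
  have Cap j h : Cinf h -> Cinf (fun y => a y * partial j h y).
    by move=> Ch; apply: CinfM => //; exact: Cinf_partial.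
  rewrite complex_sum !divergenceE// -!sumrN; congr (_ +i* _)%C;
    apply: eq_bigr => j _.
    rewrite -partialN; last exact/Cinf_derivable/Cap.
    congr (partial j _ x); apply/funext => y; rewrite DopE /=; ring.
  congr (- partial j _ x); apply/funext => y; rewrite DopE /=; ring.
rewrite PopE; move: (u x) => [r i] /=.
move: (laplacian _ _) (laplacian _ _) (divergence _ _ _) (divergence _ _ _) => b1 b2 b3 b4.
by split; ring.
Qed.

End damping.

(** * Size of the potential and return from [A u] to [u] *)

Section damped_estimate.
Context {R : realType} {d : nat}.
Local Notation E := 'rV[R]_d.
Implicit Types (phi a f h v w : E -> R) (x : E).

Lemma damping_im_sqr_le a lambda x : damping_im a lambda x ^+ 2 <= lambda ^+ 4.
Proof.
rewrite /damping_im /damping_re; have D0 := damping_den_gt0 a lambda x.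
move: (lambda * a x) D0 => s D0.
rewrite (_ : _ ^+ 2 = lambda ^+ 4 * (s ^+ 2 / (1 + s ^+ 2) ^+ 2)); last by field; rewrite gt_eqF.
rewrite ler_piMr//; first by rewrite -[4%N]/(2 * 2)%N exprM sqr_ge0.
rewrite ler_pdivrMr ?exprn_gt0// mul1r -subr_ge0.
have s2 := sqr_ge0 s; have s4 := sqr_ge0 (s ^+ 2).
rewrite sqrrD; lra.
Qed.

(** Profiles in [s = lambda a] of the squared gradients of the two parts of the potential. One
    factor [s] stems from [|grad a|^2 <= A a = A s / lambda], which also lowers [lambda^6] to
    [lambda^5]. *)
Lemma damping_coef_le (s : R) : 0 <= s ->
  s ^+ 3 / (1 + s ^+ 2) ^+ 4 <= 1 /\ s * (1 - s ^+ 2) ^+ 2 / (1 + s ^+ 2) ^+ 4 <= 1.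
Proof.
move=> s0; have D1 : 1 <= 1 + s ^+ 2 by rewrite lerDl sqr_ge0.
have sD : s <= 1 + s ^+ 2 by have := sqr_ge0 (s - 1); rewrite sqrrB; lra.
have qD : (1 - s ^+ 2) ^+ 2 <= (1 + s ^+ 2) ^+ 2.
  by rewrite -subr_ge0 (_ : _ - _ = 4 * s ^+ 2) ?mulr_ge0 ?sqr_ge0//; ring.
move: (1 + s ^+ 2) (1 - s ^+ 2) D1 sD qD => D q D1 sD qD.
have D0 : 0 <= D by lra.
have D0' : 0 < D ^+ 4 by rewrite exprn_gt0//; lra.
have D3 : D ^+ 3 <= D ^+ 4 by rewrite [leRHS]exprS ler_peMl// exprn_ge0.
split; rewrite ler_pdivrMr// mul1r; apply: le_trans D3.
  by rewrite lerXn2r ?nnegrE.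
by rewrite exprS ler_pM// sqr_ge0.
Qed.

Lemma gdot_damping_re_sqr_le a lambda phi (A : R) x : Cinf a -> 0 <= a x ->
  0 <= lambda -> 0 <= A -> gdot a a x <= A * a x ->
  gdot (damping_re a lambda) phi x ^+ 2 <= 4 * A * lambda ^+ 5 * gdot phi phi x.
Proof.
move=> Ca a0 l0 A0 aA; rewrite gdot_damping_re//.
have [sD _] := damping_coef_le (mulr_ge0 l0 a0).
have D0 := damping_den_gt0 a lambda x.
have F0 := gdot_ge0 phi x.
have := le_trans (gdot_cauchy_schwarz a phi x) (ler_wpM2r F0 aA).
move: (gdot a phi x) (gdot phi phi x) F0 => g F F0 gF.
rewrite exprMn sqrrN.
apply: (le_trans (ler_wpM2l (sqr_ge0 _) gF)).
have -> : (2 * lambda ^+ 3 * (lambda * a x) / (1 + (lambda * a x) ^+ 2) ^+ 2) ^+ 2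
     * (A * a x * F) =
   4 * A * lambda ^+ 5 * F * ((lambda * a x) ^+ 3 / (1 + (lambda * a x) ^+ 2) ^+ 4).
  by field; rewrite gt_eqF.
by rewrite ler_piMr// !mulr_ge0// exprn_ge0.
Qed.

Lemma gdot_damping_im_le a lambda (A : R) x : Cinf a -> 0 <= a x ->
  0 <= lambda -> 0 <= A -> gdot a a x <= A * a x ->
  gdot (damping_im a lambda) (damping_im a lambda) x <= A * lambda ^+ 5.
Proof.
move=> Ca a0 l0 A0 aA; rewrite gdot_damping_im// gdotC gdot_damping_im//.
have [_ sD] := damping_coef_le (mulr_ge0 l0 a0).
have D0 := damping_den_gt0 a lambda x.
rewrite mulrA -expr2; apply: (le_trans (ler_wpM2l (sqr_ge0 _) aA)).
have -> : (lambda ^+ 3 * (1 - (lambda * a x) ^+ 2) / (1 + (lambda * a x) ^+ 2) ^+ 2) ^+ 2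
     * (A * a x) = A * lambda ^+ 5 *
   ((lambda * a x) * (1 - (lambda * a x) ^+ 2) ^+ 2 / (1 + (lambda * a x) ^+ 2) ^+ 4).
  by field; rewrite gt_eqF.
by rewrite ler_piMr// mulr_ge0// exprn_ge0.
Qed.

(** With [v = v1 + i v2], the vector [e^(tau phi) (1 + i lambda a) grad u] equals [grad v - tau v
    grad phi - i lambda e^(tau phi) u grad a]; the 3 is the price of squaring three terms. *)
Lemma weighted_gradient_le phi a u1 u2 tau lambda x :
  Cinf phi -> Cinf a -> Cinf u1 -> Cinf u2 ->
  forall v1 v2, v1 = damped phi a tau (- lambda) u1 u2 ->
  v2 = damped phi a tau lambda u2 u1 ->
  expR (tau * phi x) ^+ 2 * (1 + (lambda * a x) ^+ 2) * (gdot u1 u1 x + gdot u2 u2 x) <=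
  3 * (gdot v1 v1 x + gdot v2 v2 x
       + tau ^+ 2 * gdot phi phi x * (v1 x ^+ 2 + v2 x ^+ 2)
       + lambda ^+ 2 * gdot a a x *
         (expR (tau * phi x) ^+ 2 * (u1 x ^+ 2 + u2 x ^+ 2))).
Proof.
move=> Cphi Ca C1 C2 v1 v2 v1E v2E; set e := expR _; set W := e ^+ 2 * (_ + _).
set S := v1 x ^+ 2 + _.
have -> : 3 * (gdot v1 v1 x + gdot v2 v2 x + tau ^+ 2 * gdot phi phi x * S
       + lambda ^+ 2 * gdot a a x * W) =
  \sum_j 3 * (partial j v1 x * partial j v1 x + partial j v2 x * partial j v2 x
     + tau ^+ 2 * (partial j phi x * partial j phi x) * S
     + lambda ^+ 2 * (partial j a x * partial j a x) * W).
  by rewrite -mulr_sumr !big_split /= -!mulr_suml -!mulr_sumr.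
rewrite /gdot -big_split mulr_sumr; apply: ler_sum => j _ /=.
have := partial_damped tau (- lambda) j x Cphi Ca C1 C2.
have := partial_damped tau lambda j x Cphi Ca C2 C1.
rewrite -v1E -v2E -/e {}/W {}/S.
move: (partial j v1 x) (partial j v2 x) (partial j phi x) (partial j a x).
move: (partial j u1 x) (partial j u2 x) (v1 x) (v2 x) (u1 x) (u2 x) (a x) e.
move=> d1 d2 z1 z2 w1 w2 s e p1 p2 f b p2E p1E.
have h1 : e * (d1 - lambda * s * d2) = p1 - tau * f * z1 + e * (lambda * b * w2).
  by rewrite p1E; ring.
have h2 : e * (d2 + lambda * s * d1) = p2 - tau * f * z2 - e * (lambda * b * w1).
  by rewrite p2E; ring.
have -> : e ^+ 2 * (1 + (lambda * s) ^+ 2) * (d1 * d1 + d2 * d2) =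
  (e * (d1 - lambda * s * d2)) ^+ 2 + (e * (d2 + lambda * s * d1)) ^+ 2 by ring.
rewrite h1 h2.
have sq3 (p q r : R) : (p - q + r) ^+ 2 <= 3 * (p ^+ 2 + q ^+ 2 + r ^+ 2).
  rewrite -subr_ge0 (_ : _ - _ = (p + q) ^+ 2 + (q + r) ^+ 2 + (p - r) ^+ 2); last by ring.
  by rewrite !addr_ge0 ?sqr_ge0.
have := sq3 p1 (tau * f * z1) (e * (lambda * b * w2)).
have := sq3 p2 (tau * f * z2) (- (e * (lambda * b * w1))).
move=> g2 g1; apply: (le_trans (lerD g1 g2)).
by rewrite le_eqVlt; apply/orP; left; apply/eqP; ring.
Qed.

End damped_estimate.

(** * Absorption of the remainder of the substitution *)

Section absorption.
Context {R : realType}.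

(** The remainder costs [lambda Y] and [lambda^2 X], a fraction [1 / K] of what the left-hand side
    controls. The hypothesis [lambda ^+ 2 * gaa <= A * lambda * wt] is decisive: a cost [lambda^2 Y]
    would exceed [tau Y] for [tau] of order [lambda^(5/4)]. *)
Lemma absorption_arith (c A B K lambda tau X Y G F P1 P2 H1 H2 g1 g2 w1 w2 l e wt
    gaa du flux : R) :
  0 < c -> 0 <= A -> 0 <= B -> 1 <= K -> 1 <= lambda -> K * lambda <= tau ->
  0 <= G -> 0 <= gaa -> 0 <= du -> F <= B -> 1 <= wt ->
  X = e ^+ 2 * wt * (w1 ^+ 2 + w2 ^+ 2) -> Y = e ^+ 2 * wt * du ->
  Y <= 3 * (G + tau ^+ 2 * F * X + lambda ^+ 2 * gaa * (e ^+ 2 * (w1 ^+ 2 + w2 ^+ 2))) ->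
  H1 = e * (P1 + lambda * (g2 + w2 * l)) -> H2 = e * (P2 - lambda * (g1 + w1 * l)) ->
  g1 ^+ 2 + g2 ^+ 2 <= gaa * du -> lambda ^+ 2 * gaa <= A * lambda * wt -> l ^+ 2 <= A ->
  c / 2 * (tau * G + tau ^+ 3 * X) <= H1 ^+ 2 + H2 ^+ 2 - flux ->
  12 * A * (1 + A + B) + 4 * A <= c / 4 * K ->
  tau ^+ 3 * X + tau * Y <=
    (4 + 3 * A + 3 * B) * (4 / c) * (2 * e ^+ 2 * (P1 ^+ 2 + P2 ^+ 2) - flux).
Proof.
move=> c0 A0 B0 K1 l1 Kl G0 gaa0 du0 FB wt1 XE YE HY H1E H2E Hg Haa Hl Hest HK.
have t1 : 1 <= tau by apply: le_trans Kl; rewrite -[1]mulr1 ler_pM.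
have lt_ : lambda <= tau by apply: le_trans Kl; rewrite ler_peMl//; lra.
have [l0 t0] : 0 <= lambda /\ 0 <= tau by split; lra.
have e20 := sqr_ge0 e.
have u0 : 0 <= w1 ^+ 2 + w2 ^+ 2 by rewrite addr_ge0 ?sqr_ge0.
have wt0 : 0 <= wt by lra.
have X0 : 0 <= X by rewrite XE; apply: mulr_ge0 => //; exact: mulr_ge0.
have Y0 : 0 <= Y by rewrite YE; apply: mulr_ge0 => //; exact: mulr_ge0.
have euX : e ^+ 2 * (w1 ^+ 2 + w2 ^+ 2) <= X.
  by rewrite XE [leRHS]mulrAC; apply: ler_peMr => //; exact: mulr_ge0.
have Haa' Z : 0 <= Z -> lambda ^+ 2 * gaa * Z <= A * lambda * (wt * Z).
  by move=> Z0; rewrite [leRHS]mulrA ler_wpM2r.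
have HY' : Y <= 3 * (G + tau ^+ 2 * B * X + A * lambda * X).
  apply: (le_trans HY); rewrite ler_pM2l//; apply: lerD.
    by rewrite lerD2l ler_wpM2r// ler_wpM2l// sqr_ge0.
  apply: (le_trans (Haa' _ (mulr_ge0 e20 u0))).
  by rewrite XE le_eqVlt; apply/orP; left; apply/eqP; ring.
have lX : lambda ^+ 2 * (e ^+ 2 * (l ^+ 2 * (w1 ^+ 2 + w2 ^+ 2))) <= A * lambda ^+ 2 * X.
  rewrite (_ : lambda ^+ 2 * _ =
    l ^+ 2 * (lambda ^+ 2 * (e ^+ 2 * (w1 ^+ 2 + w2 ^+ 2)))); last by ring.
  rewrite -[leRHS]mulrA; apply: ler_pM => //; rewrite ?sqr_ge0//.
    by apply: mulr_ge0; [exact: sqr_ge0|exact: mulr_ge0].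
  by rewrite ler_wpM2l// sqr_ge0.
have gY : lambda ^+ 2 * (e ^+ 2 * (g1 ^+ 2 + g2 ^+ 2)) <= A * lambda * Y.
  apply: (@le_trans _ _ (lambda ^+ 2 * gaa * (e ^+ 2 * du))).
    rewrite -[leRHS]mulrA ler_wpM2l ?sqr_ge0//.
    by rewrite [leRHS]mulrCA ler_wpM2l.
  apply: (le_trans (Haa' _ (mulr_ge0 e20 du0))).
  by rewrite YE le_eqVlt; apply/orP; left; apply/eqP; ring.
have HH : H1 ^+ 2 + H2 ^+ 2 <=
    2 * e ^+ 2 * (P1 ^+ 2 + P2 ^+ 2) + 4 * (A * lambda * Y + A * lambda ^+ 2 * X).
  apply: (@le_trans _ _ (2 * e ^+ 2 * (P1 ^+ 2 + P2 ^+ 2) +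
    4 * (lambda ^+ 2 * (e ^+ 2 * (g1 ^+ 2 + g2 ^+ 2)) +
         lambda ^+ 2 * (e ^+ 2 * (l ^+ 2 * (w1 ^+ 2 + w2 ^+ 2)))))); last lra.
  rewrite H1E H2E -subr_ge0 (_ : _ - _ = e ^+ 2 *
    ((P1 - lambda * (g2 + w2 * l)) ^+ 2 + (P2 + lambda * (g1 + w1 * l)) ^+ 2
     + 2 * lambda ^+ 2 * ((g2 - w2 * l) ^+ 2 + (g1 - w1 * l) ^+ 2))); last by ring.
  apply: mulr_ge0 => //; apply: addr_ge0; first by apply: addr_ge0; exact: sqr_ge0.
  apply: mulr_ge0; last by apply: addr_ge0; exact: sqr_ge0.
  by apply: mulr_ge0 => //; exact: sqr_ge0.
have [T3 [T3E T30]] : exists T3, T3 = tau ^+ 3 * X /\ 0 <= T3.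
  by exists (tau ^+ 3 * X); split=> //; rewrite mulr_ge0 ?exprn_ge0.
have t2X : tau ^+ 2 * X <= T3.
  by rewrite T3E ler_wpM2r// [leRHS]exprS ler_peMl ?sqr_ge0.
have llX : K * (lambda ^+ 2 * X) <= T3.
  apply: le_trans t2X; rewrite mulrA ler_wpM2r// expr2 mulrA.
  by rewrite expr2 ler_pM// mulr_ge0//; lra.
have lG : K * (lambda * G) <= tau * G by rewrite mulrA ler_wpM2r.
have lB : K * (lambda * (tau ^+ 2 * B * X)) <= B * T3.
  rewrite T3E (_ : B * _ = tau * (tau ^+ 2 * B * X)); last by ring.
  rewrite mulrA; apply: ler_wpM2r => //; apply: mulr_ge0 => //.
  by apply: mulr_ge0 => //; exact: sqr_ge0.
have lY : K * (lambda * Y) <= 3 * (tau * G + B * T3 + A * T3).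
  have : K * (lambda * Y) <= K * (lambda * (3 * (G + tau ^+ 2 * B * X + A * lambda * X))).
    by rewrite ler_wpM2l ?ler_wpM2l//; lra.
  have := ler_wpM2l A0 llX; rewrite !mulrDr; lra.
have tG0 : 0 <= tau * G by rewrite mulr_ge0.
have tY : tau * Y <= 3 * (tau * G + B * T3 + A * T3).
  have : tau * Y <= tau * (3 * (G + tau ^+ 2 * B * X + A * lambda * X)) by rewrite ler_wpM2l.
  have -> : tau * (3 * (G + tau ^+ 2 * B * X + A * lambda * X)) =
    3 * (tau * G + B * T3 + A * (tau * lambda * X)) by rewrite T3E; ring.
  have : A * (tau * lambda * X) <= A * T3.
    apply: ler_wpM2l => //; apply: le_trans t2X.
    by rewrite expr2 ler_wpM2r// ler_wpM2l.
  lra.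
have K0 : 0 < K by lra.
(* After multiplication by [K], [lY] contributes [12 A (1 + A + B)] and [llX] contributes [4 A],
   which is the left-hand side of the condition on [K]. *)
have absorb : 4 * (A * lambda * Y + A * lambda ^+ 2 * X) <= c / 4 * (tau * G + T3).
  rewrite -(ler_pM2l K0).
  apply: (@le_trans _ _ ((12 * A * (1 + A + B) + 4 * A) * (tau * G + T3))); last first.
    rewrite [leRHS]mulrA [K * _]mulrC; apply: ler_wpM2r => //; exact: addr_ge0.
  have := ler_wpM2l A0 lY; have := ler_wpM2l A0 llX.
  have A_ := mulr_ge0 A0 tG0; have := mulr_ge0 A0 A_.
  have := mulr_ge0 B0 A_; have := mulr_ge0 A0 T30.
  lra.
have main : c / 4 * (tau * G + T3) <= 2 * e ^+ 2 * (P1 ^+ 2 + P2 ^+ 2) - flux.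
  by rewrite -T3E in Hest; lra.
rewrite -T3E; apply: (@le_trans _ _ ((4 + 3 * A + 3 * B) * (tau * G + T3))).
  have := mulr_ge0 A0 T30; have := mulr_ge0 B0 T30.
  have := mulr_ge0 A0 tG0; have := mulr_ge0 B0 tG0; lra.
rewrite -mulrA; apply: ler_wpM2l; first lra.
rewrite -(ler_pM2l (x := c / 4)) ?divr_gt0//.
by rewrite [leRHS]mulrA (_ : c / 4 * (4 / c) = 1) ?mul1r//; field; rewrite gt_eqF.
Qed.

End absorption.

(** * Elementary inequalities for large parameters *)

Section large_parameters.
Context {R : realType}.

Lemma large_parameters (K l t : R) : 1 <= K -> 1 <= l -> K * l <= t ->
  [/\ 0 < K, 0 <= l, K <= t & 1 <= t].
Proof. by move=> K1 l1 Kl; split; nra. Qed.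

Lemma sqrB_le (g k a b e : R) : g ^+ 2 <= a -> k ^+ 2 <= b -> 2 * (a + b) <= e ->
  (g - k) ^+ 2 <= e.
Proof. by move=> ga kb abe; have := sqr_ge0 (g + k); rewrite sqrrB sqrrD; lra. Qed.

Lemma ler_1Dsqr (s : R) : s <= 1 + s ^+ 2.
Proof.
by have := sqr_ge0 (s - 1); have := sqr_ge0 s; rewrite sqrrB; lra.
Qed.

End large_parameters.

(** * The pointwise estimate for the damped operator *)

Section damped_carleman.
Context {R : realType} {d : nat}.
Local Notation E := 'rV[R]_d.
Implicit Types (phi a f h v w : E -> R) (x : E).

Definition damped_flux phi kappa a tau lambda u1 u2 x : R :=
  let p := damping_re a lambda in let q := damping_im a lambda in
  let v1 := damped phi a tau (- lambda) u1 u2 in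
  let v2 := damped phi a tau lambda u2 u1 in
  carleman_flux phi kappa p tau v1 x + carleman_flux phi kappa p tau v2 x
  + divergence (fun y => q y * v2 y) v1 x - divergence (fun y => q y * v1 y) v2 x.

Definition mass phi a tau lambda u1 u2 x : R :=
  expR (tau * phi x) ^+ 2 * (1 + (lambda * a x) ^+ 2) * (u1 x ^+ 2 + u2 x ^+ 2).

Definition energy phi a tau lambda u1 u2 x : R :=
  expR (tau * phi x) ^+ 2 * (1 + (lambda * a x) ^+ 2) * (gdot u1 u1 x + gdot u2 u2 x).

Definition source phi a tau lambda u1 u2 x : R :=
  expR (tau * phi x) ^+ 2 *
  ((- laplacian u1 x + lambda * divergence a u2 x - lambda ^+ 2 * u1 x) ^+ 2 +
   (- laplacian u2 x - lambda * divergence a u1 x - lambda ^+ 2 * u2 x) ^+ 2).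

(** The lower bounds on [tau] serve different terms: [K * lambda ^+ 5 <= tau ^+ 4] makes the
    potential terms small, [K * lambda <= tau] lets [absorption_arith] remove the remainder of the
    substitution. *)
Lemma damped_estimate (c M A B r K : R) phi kappa a lambda tau u1 u2 x :
  Cinf phi -> Cinf kappa -> Cinf a -> Cinf u1 -> Cinf u2 ->
  0 < c -> 0 <= M -> 0 <= A -> 0 <= B -> 1 <= K -> 1 <= lambda ->
  K * lambda <= tau -> K * lambda ^+ 5 <= tau ^+ 4 ->
  (forall z, c * dot z z - M * dot (grad phi x) z ^+ 2 <=
             hess phi z z x + 2^-1 * kappa x * dot z z) ->
  c <= hess phi (grad phi x) (grad phi x) x - 2^-1 * kappa x * gdot phi phi x ->
  2 * (gdot (laplacian phi) (laplacian phi) x + gdot kappa kappa x) <= B ->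
  laplacian phi x ^+ 2 <= B -> kappa x ^+ 2 <= B -> gdot phi phi x <= B ->
  0 <= a x -> gdot a a x <= A * a x -> laplacian a x ^+ 2 <= A ->
  0 < r -> (3 / 2 * M + c^-1 + 2) * r <= c / 4 ->
  B <= r * K -> 1 <= r * K -> 8 * A * B + 2 * B <= r ^+ 2 * K ->
  A <= c ^+ 2 / 8 * K -> 6 * M <= K -> 12 * A * (1 + A + B) + 4 * A <= c / 4 * K ->
  tau ^+ 3 * mass phi a tau lambda u1 u2 x + tau * energy phi a tau lambda u1 u2 x <=
    (4 + 3 * A + 3 * B) * (4 / c) *
    (2 * source phi a tau lambda u1 u2 x - damped_flux phi kappa a tau lambda u1 u2 x).
Proof.
move=> Cphi Ck Ca C1 C2 c0 M0 A0 B0 K1 l1 Kl Kl5 conv HQ HdL HL Hk HF a0 aA lA r0 Hr.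
move=> BrK rK ABK AK MK absK.
have [K0 l0 Kt t1] := large_parameters K1 l1 Kl.
have l45 : lambda ^+ 4 <= lambda ^+ 5 by rewrite [leRHS]exprS ler_peMl// exprn_ge0.
have [v1 v1E] : exists v1, v1 = damped phi a tau (- lambda) u1 u2 by eexists.
have [v2 v2E] : exists v2, v2 = damped phi a tau lambda u2 u1 by eexists.
have Cv1 : Cinf v1 by rewrite v1E; exact: Cinf_damped.
have Cv2 : Cinf v2 by rewrite v2E; exact: Cinf_damped.
have Cp := Cinf_damping_re lambda Ca; have Cq := Cinf_damping_im lambda Ca.
have scale (b e : R) : 0 <= e -> b <= e * K -> b * lambda ^+ 5 <= e * tau ^+ 4.
  move=> e0 be; apply: (@le_trans _ _ (e * K * lambda ^+ 5)).
    by rewrite ler_wpM2r// exprn_ge0.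
  by rewrite -mulrA ler_wpM2l.
have Hq : damping_im a lambda x ^+ 2 <= r * tau ^+ 4.
  apply: (le_trans (damping_im_sqr_le a lambda x)); apply: (le_trans l45).
  by rewrite -[leLHS]mul1r scale// ltW.
have Hp : - (r * tau ^+ 2) <= gdot (damping_re a lambda) phi x - kappa x * damping_re a lambda x.
  have h1 := gdot_damping_re_sqr_le phi Ca a0 l0 A0 aA.
  have h2 : (kappa x * damping_re a lambda x) ^+ 2 <= B * lambda ^+ 5.
    rewrite exprMn; apply: ler_pM => //; rewrite ?sqr_ge0//; apply: le_trans l45.
    have D0 := damping_den_gt0 a lambda x.
    rewrite -[4%N]/(2 * 2)%N exprM lerXn2r ?nnegrE ?sqr_ge0//.
      by rewrite divr_ge0 ?sqr_ge0// ltW.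
    by rewrite ler_pdivrMr// ler_peMr ?sqr_ge0// lerDl sqr_ge0.
  have h3 : 4 * A * lambda ^+ 5 * gdot phi phi x <= 4 * A * B * lambda ^+ 5.
    rewrite (mulrAC (4 * A)); apply: ler_wpM2r; first exact: exprn_ge0.
    by apply: ler_wpM2l => //; exact: mulr_ge0.
  have h4 := scale _ _ (sqr_ge0 r) ABK.
  rewrite lerNl; apply: ler_pnorm_sqr; last by rewrite mulr_ge0 ?(ltW r0)// sqr_ge0.
  rewrite sqrrN exprMn -exprM; apply: (sqrB_le (le_trans h1 h3) h2).
  by apply: le_trans h4; rewrite le_eqVlt; apply/orP; left; apply/eqP; ring.
have Hdq : gdot (damping_im a lambda) (damping_im a lambda) x <= c ^+ 2 / 8 * tau ^+ 4.
  apply: (le_trans (gdot_damping_im_le Ca a0 l0 A0 aA)).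
  by apply: scale => //; rewrite divr_ge0// sqr_ge0.
have [E1 E2] := conjugated_damped x Cphi Ca C1 C2 v1E v2E.
have est := carleman_pointwise Cphi Ck Cp Cq Cv1 Cv2 c0 M0 t1 B0 conv HQ HdL HL Hk
  (le_trans BrK (ler_wpM2l (ltW r0) Kt)) Hq Hp Hdq (le_trans MK Kt) Hr erefl erefl.
rewrite E1 E2 in est.
have massE : mass phi a tau lambda u1 u2 x = v1 x ^+ 2 + v2 x ^+ 2.
  by rewrite /mass v1E v2E /damped; ring.
rewrite -massE in est.
have HY := weighted_gradient_le x Cphi Ca C1 C2 v1E v2E; rewrite -massE in HY.
have G0 : 0 <= gdot v1 v1 x + gdot v2 v2 x by rewrite addr_ge0 ?gdot_ge0.
rewrite /damped_flux /= -v1E -v2E /source [2 * (_ * _)]mulrA.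
apply: (absorption_arith c0 A0 B0 K1 l1 Kl G0 (gdot_ge0 a x)
  (addr_ge0 (gdot_ge0 u1 x) (gdot_ge0 u2 x)) HF _ erefl erefl HY erefl erefl _ _
  lA est absK).
- by rewrite lerDl sqr_ge0.
- by rewrite mulrDr lerD// gdot_cauchy_schwarz.
(* The bound [|grad a|^2 <= A a] turns one power of [lambda] into [lambda a], which the weight
   [1 + (lambda a)^2] dominates. *)
- have s1 := ler_1Dsqr (lambda * a x).
  apply: (@le_trans _ _ (lambda ^+ 2 * (A * a x))); first by rewrite ler_wpM2l// sqr_ge0.
  rewrite (_ : lambda ^+ 2 * _ = A * lambda * (lambda * a x)); last by ring.
  by rewrite ler_wpM2l// mulr_ge0.
Qed.

End damped_carleman.

(** * Vanishing off the support, and functions of zero integral *)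

Section supports.
Context {R : realType} {d : nat}.
Local Notation E := 'rV[R]_d.
Implicit Types (phi a f h v w : E -> R) (x : E).

Lemma compact_norm_bound (A : set E) : compact A ->
  exists M : R, forall x, M <= `|x| -> ~ A x.
Proof.
move=> /compact_bounded[M [_ HM]]; exists (M + 2) => x Mx Ax.
have : `|x| <= M + 1 by apply: HM => //; rewrite ltrDl.
by apply/negP; rewrite -ltNge (lt_le_trans _ Mx)// ltrD2l ltr1n.
Qed.

Lemma near_partial_eq0 f j x : (\forall y \near x, f y = 0) ->
  \forall y \near x, partial j f y = 0.
Proof.
rewrite -nbhs_nearE => /nbhs_interior; apply: filterS => y fy.
by rewrite /partial (@near_eq_derive _ _ _ _ (cst 0)) ?derive_cst.
Qed.

Lemma near_partials_eq0 f x : (\forall y \near x, f y = 0) ->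
  [/\ f x = 0, forall j, partial j f x = 0, laplacian f x = 0 &
      forall g, gdot g f x = 0].
Proof.
move=> fx; have pf j : partial j f x = 0.
  exact: nbhs_singleton (near_partial_eq0 j fx).
split => //; first exact: nbhs_singleton fx.
  rewrite /laplacian big1// => j _.
  exact: nbhs_singleton (near_partial_eq0 j (near_partial_eq0 j fx)).
by move=> g; rewrite /gdot big1// => j _; rewrite pf mulr0.
Qed.

Lemma near_damped_eq0 phi a tau c w w' x : (\forall y \near x, w y = 0) ->
  (\forall y \near x, w' y = 0) -> \forall y \near x, damped phi a tau c w w' y = 0.
Proof. by apply: filterS2 => y wy w'y; rewrite /damped wy w'y mulr0 addr0 mulr0. Qed.

(* [carleman_identity] expresses the flux at [x] by products involving the values at [x]
   of [v], [w] and their derivatives. *)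
Lemma damped_flux_eq0 phi kappa a tau lambda u1 u2 x :
  Cinf phi -> Cinf kappa -> Cinf a -> Cinf u1 -> Cinf u2 ->
  (\forall y \near x, u1 y = 0) -> (\forall y \near x, u2 y = 0) ->
  damped_flux phi kappa a tau lambda u1 u2 x = 0.
Proof.
move=> Cphi Ck Ca C1 C2 u1x u2x.
have [v1 v1E] : exists v1, v1 = damped phi a tau (- lambda) u1 u2 by eexists.
have [v2 v2E] : exists v2, v2 = damped phi a tau lambda u2 u1 by eexists.
have Cv1 : Cinf v1 by rewrite v1E; exact: Cinf_damped.
have Cv2 : Cinf v2 by rewrite v2E; exact: Cinf_damped.
have v1x : \forall y \near x, v1 y = 0 by rewrite v1E; exact: near_damped_eq0.
have v2x : \forall y \near x, v2 y = 0 by rewrite v2E; exact: near_damped_eq0.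
have Cp := Cinf_damping_re lambda Ca; have Cq := Cinf_damping_im lambda Ca.
have := carleman_identity tau x Cphi Ck Cp Cq Cv1 Cv2.
rewrite /damped_flux /= -v1E -v2E.
set flux := _ + _ + _ - divergence _ _ _.
have [z1 g1 l1 d1] := near_partials_eq0 v1x.
have [z2 g2 l2 d2] := near_partials_eq0 v2x.
have hess0 v : (forall j, partial j v x = 0) -> hess phi (grad v x) (grad v x) x = 0.
  move=> gv; rewrite /hess big1// => j _; rewrite big1// => k _.
  by rewrite !mxE !gv mulr0.
have T0 q v w : v x = 0 -> w x = 0 -> gdot phi v x = 0 -> carleman_T phi q tau v w x = 0.
  by move=> vx wx gv; rewrite /carleman_T vx wx gv !mulr0 addr0 subr0.
have S0 p v : v x = 0 -> laplacian v x = 0 -> carleman_S phi p tau v x = 0.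
  by move=> vx lv; rewrite /carleman_S vx lv mulr0 subr0 oppr0.
have F0 p v : v x = 0 -> gdot v v x = 0 -> (forall j, partial j v x = 0) ->
    carleman_form phi kappa p tau v 0 x = 0.
  move=> vx gv pv; rewrite /carleman_form vx gv hess0// expr0n /=.
  by rewrite !(mulr0, mul0r, addr0).
rewrite !T0 ?S0 ?F0 ?z1 ?z2 ?d1 ?d2//.
by rewrite !(mulr0, mul0r, addr0, add0r, oppr0) => <-.
Qed.

Definition null_integral (f : E -> R) : Prop :=
  (lebesgue_tuple d).-integrable setT (fun t => (f (rV_of_tuple t))%:E) /\
  (\int[lebesgue_tuple d]_t (f (rV_of_tuple t))%:E = 0)%E.

Lemma null_integralD f h : null_integral f -> null_integral h ->
  null_integral (fun x => f x + h x).
Proof.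
move=> [if1 f0] [ih h0]; split.
  by under eq_fun do rewrite EFinD; exact: integrableD.
by under eq_integral do rewrite EFinD; rewrite integralD// f0 h0 adde0.
Qed.

Lemma null_integralZ (c : R) f : null_integral f -> null_integral (fun x => c * f x).
Proof.
move=> [if1 f0]; split.
  by under eq_fun do rewrite EFinM; exact: integrableZl.
by under eq_integral do rewrite EFinM; rewrite integralZl// f0 mule0.
Qed.

Lemma null_integralB f h : null_integral f -> null_integral h ->
  null_integral (fun x => f x - h x).
Proof.
move=> nf nh; rewrite (_ : (fun x => _) = fun x => f x + -1 * h x).
  by apply: null_integralD => //; exact: null_integralZ.
by apply/funext => x; rewrite mulN1r.
Qed.

Lemma null_damped_flux phi kappa a tau lambda u1 u2 (M : R) :
  Cinf phi -> Cinf kappa -> Cinf a -> Cinf u1 -> Cinf u2 ->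
  vanishing M u1 -> vanishing M u2 ->
  null_integral (damped_flux phi kappa a tau lambda u1 u2).
Proof.
move=> Cphi Ck Ca C1 C2 V1 V2.
have [v1 v1E] : exists v1, v1 = damped phi a tau (- lambda) u1 u2 by eexists.
have [v2 v2E] : exists v2, v2 = damped phi a tau lambda u2 u1 by eexists.
have Cv1 : Cinf v1 by rewrite v1E; exact: Cinf_damped.
have Cv2 : Cinf v2 by rewrite v2E; exact: Cinf_damped.
have Vv1 : vanishing M v1.
  by move=> x Mx; rewrite v1E /damped V1// V2// mulr0 addr0 mulr0.
have Vv2 : vanishing M v2.
  by move=> x Mx; rewrite v2E /damped V1// V2// mulr0 addr0 mulr0.
have Cp := Cinf_damping_re lambda Ca; have Cq := Cinf_damping_im lambda Ca.
have nd f h (N : R) : Cinf f -> Cinf h -> vanishing N f \/ vanishing N h ->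
    null_integral (divergence f h).
  exact: integral_divergence.
have flux p v : Cinf p -> Cinf v -> vanishing M v ->
    null_integral (carleman_flux phi kappa p tau v).
  move=> Cp' Cv Vv; rewrite /carleman_flux.
  have CL := Cinf_laplacian Cphi; have CF := Cinf_gdot Cphi Cphi.
  have Ct c : Cinf (fun _ : E => c) by exact: Cinf_cst.
  do ![apply: null_integralB]; apply: null_integralZ.
  (* The factor that vanishes is [|grad v|^2], hence the larger radius. *)
  - apply: (nd _ _ (M + 1)) => //; first exact: Cinf_gdot.
    left=> x Mx; rewrite /gdot big1// => j _.
    by rewrite (vanishing_partial j Vv) ?mul0r.
  - by apply: (nd _ _ M) => //; [exact: Cinf_gdot|right].
  - by apply: (nd _ _ M) => //; [exact: CinfM|right].
  - apply: (nd _ _ M) => //; last by left=> x Mx; rewrite Vv// !mulr0.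
    by apply: CinfM; [apply: CinfD => //; exact: CinfM|exact: CinfM].
  - by apply: (nd _ _ M) => //; [exact: CinfM|right].
rewrite (_ : damped_flux _ _ _ _ _ _ _ = fun x =>
  carleman_flux phi kappa (damping_re a lambda) tau v1 x
  + carleman_flux phi kappa (damping_re a lambda) tau v2 x
  + divergence (fun y => damping_im a lambda y * v2 y) v1 x
  - divergence (fun y => damping_im a lambda y * v1 y) v2 x); last first.
  by rewrite v1E v2E.
apply: null_integralB; last by apply: (nd _ _ M) => //; [exact: CinfM|right].
apply: null_integralD; last by apply: (nd _ _ M) => //; [exact: CinfM|right].
by apply: null_integralD; exact: flux.
Qed.

End supports.

(** * Squared norms as integrals over the whole space *)

Section L2_norms.
Context {R : realType} {d : nat}.
Local Notation E := 'rV[R]_d.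
Implicit Types (phi a f h v w : E -> R) (x : E).

(** Replacing the restriction to [V] by an integral over the whole space matters because that is
    where divergences integrate to zero. *)
Lemma L2norm_modulus_sqr (V : set E) f : (forall x, ~ V x -> f x = 0) ->
  (L2norm_modulus V f ^+ 2 = \int[lebesgue_tuple d]_t (f (rV_of_tuple t) ^+ 2)%:E)%E.
Proof.
move=> fV; rewrite /L2norm_modulus unlock.
have -> : f \_ V = f.
  by apply/funext => x; rewrite patchE; case: ifPn => // /negP; rewrite inE => /fV.
rewrite poweR12_sqrt; last by apply: integral_ge0 => t _; exact: poweR_ge0.
rewrite sqr_sqrte; last by apply: integral_ge0 => t _; exact: poweR_ge0.
apply: eq_integral => t _ /=.
by rewrite powR_mulrn// real_normK// num_real.
Qed.

Lemma normc_sqr (c : R) (z : R[i]) :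
  Normc.normc (c%:C%C * z) ^+ 2 = c ^+ 2 * (complex.Re z ^+ 2 + complex.Im z ^+ 2).
Proof.
case: z => r i /=; rewrite sqr_sqrtr ?addr_ge0 ?sqr_ge0//.
by ring.
Qed.

Lemma cenorm_sqr (w : 'rV[R[i]]_d) :
  cenorm w ^+ 2 = \sum_j Normc.normc (w ord0 j) ^+ 2.
Proof. by rewrite sqr_sqrtr// sumr_ge0// => j _; exact: sqr_ge0. Qed.

(** The function [h] stands for a multiple of the flux: it enters the pointwise inequality with
    either sign and disappears on integration. *)
Lemma integral_smooth_le f1 f2 g h (M c1 c2 C : R) :
  Cinf f1 -> Cinf f2 -> Cinf g -> vanishing M f1 -> vanishing M f2 ->
  vanishing M g -> null_integral h ->
  (forall x, c1 * f1 x + c2 * f2 x <= C * g x + h x) ->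
  (c1%:E * \int[lebesgue_tuple d]_t (f1 (rV_of_tuple t))%:E +
   c2%:E * \int[lebesgue_tuple d]_t (f2 (rV_of_tuple t))%:E <=
   C%:E * \int[lebesgue_tuple d]_t (g (rV_of_tuple t))%:E)%E.
Proof.
move=> C1 C2 Cg v1 v2 vg [ih h0] le12.
have i1 := integrable_continuous (Cinf_continuous C1) v1.
have i2 := integrable_continuous (Cinf_continuous C2) v2.
have ig := integrable_continuous (Cinf_continuous Cg) vg.
have j1 := integrableZl measurableT c1 i1; have j2 := integrableZl measurableT c2 i2.
have jg := integrableZl measurableT C ig.
rewrite -!integralZl// -integralD// -[leRHS]adde0 -h0 -integralD//.
apply: le_integral => //; [exact: integrableD|exact: integrableD|].
by move=> t _; rewrite -!EFinM -!EFinD lee_fin.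
Qed.

End L2_norms.

(** * Bounds on the data and choice of the constants *)

Section constants.
Context {R : realType} {d : nat}.
Local Notation E := 'rV[R]_d.
Implicit Types (phi a f h v w : E -> R) (x : E).

(** Compact support bounds the second derivatives globally; nonnegativity converts this, through
    [partial_sqr_le], into a bound on the gradient. *)
Lemma test_function_bounds (Omega : set E) a : test_function Omega a ->
  (forall x, 0 <= a x) ->
  exists2 A, 0 <= A & forall x, gdot a a x <= A * a x /\ laplacian a x ^+ 2 <= A.
Proof.
move=> [/smooth_Cinf Ca /compact_norm_bound[M HM] _] a0.
have va : vanishing M a.
  move=> x /HM/= ax; apply/eqP/negPn/negP => ax0; apply: ax.
  exact: subset_closure.
have /choice[b Hb] : forall j, exists b, forall x, `|partial j (partial j a) x| <= b.
  move=> j; apply: (@continuous_bounded _ _ _ (M + 1 + 1)).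
    exact/Cinf_continuous/Cinf_partial/Cinf_partial.
  exact/vanishing_partial/vanishing_partial.
have b0 j : 0 <= b j by exact: le_trans (Hb j 0).
have lb x : `|laplacian a x| <= \sum_j b j.
  by apply: le_trans (ler_norm_sum _ _ _) _; apply: ler_sum => j _.
have sb : 0 <= \sum_j b j by exact: sumr_ge0.
exists (4 * (\sum_j b j) + (\sum_j b j) ^+ 2).
  by rewrite addr_ge0 ?sqr_ge0// mulr_ge0.
move=> x; split.
  apply: (@le_trans _ _ (4 * (\sum_j b j) * a x)).
    rewrite mulr_sumr mulr_suml; apply: ler_sum => j _; rewrite -expr2.
    exact: partial_sqr_le.
  by rewrite ler_wpM2r// lerDl sqr_ge0.
apply: (@le_trans _ _ ((\sum_j b j) ^+ 2)); last by rewrite lerDr mulr_ge0.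
by rewrite -(real_normK (num_real (laplacian a x))) lerXn2r ?nnegrE.
Qed.

Lemma compact_closure_bounded (V Omega : set E) : bounded_set Omega ->
  V `<=` Omega -> compact (closure V).
Proof.
move=> [M [Mr HM]] VO; apply: bounded_closed_compact; last exact: closed_closure.
exists (M + 1); split; first exact: num_real.
move=> N MN x /=; have cl : closed [set y : E | `|y| <= N].
  have -> : [set y : E | `|y| <= N] = (fun y => `|y|) @^-1` [set z : R | z <= N] by [].
  apply: preimage_closed; last exact: closed_le.
  by move=> y _; exact: norm_continuous.
suff : closure V `<=` [set y | `|y| <= N] by exact.
rewrite [X in _ `<=` X]((closure_id _).1 cl).
by apply: closureS => y /VO Oy; apply: HM => //; rewrite (lt_trans _ MN)// ltrDl.
Qed.

(** The fractional power enters the estimates only through these two polynomial bounds, which rely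
    on [lambda <= lambda^(5/4)] and [K <= K^4]. *)
Lemma powR_large (K lambda tau : R) : 1 <= K -> 1 <= lambda ->
  K * `|lambda| `^ (5 / 4) <= tau ->
  K * lambda <= tau /\ K * lambda ^+ 5 <= tau ^+ 4.
Proof.
move=> K1 l1; have l0 : 0 <= lambda by exact: le_trans l1.
rewrite ger0_norm// => Ht; have K0 : 0 <= K by exact: le_trans K1.
have p0 := powR_ge0 lambda (5 / 4); split.
  apply: le_trans Ht; rewrite ler_wpM2l// -[leLHS](powRr1 l0).
  by apply: ler_powR => //; lra.
have -> : lambda ^+ 5 = (lambda `^ (5 / 4)) ^+ 4.
  rewrite -!powR_mulrn// -powRrM; congr (_ `^ _); lra.
apply: (@le_trans _ _ ((K * lambda `^ (5 / 4)) ^+ 4)).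
  rewrite exprMn ler_wpM2r ?exprn_ge0//.
  by rewrite [leRHS]exprS ler_peMr// exprn_ege1.
by rewrite lerXn2r ?nnegrE ?mulr_ge0// (le_trans _ Ht)// mulr_ge0.
Qed.

(** The order matters: [r] depends on [c] and [M] alone, after which every condition is of the form
    [b <= e * K] with [e > 0] fixed, or [K] at least a constant. *)
Lemma constants_exist (c M A B : R) : 0 < c -> 0 <= M -> 0 <= A -> 0 <= B ->
  exists r K, [/\ 0 < r, 1 <= K, (3 / 2 * M + c^-1 + 2) * r <= c / 4 &
   [/\ B <= r * K, 1 <= r * K, 8 * A * B + 2 * B <= r ^+ 2 * K,
       A <= c ^+ 2 / 8 * K & 6 * M <= K /\ 12 * A * (1 + A + B) + 4 * A <= c / 4 * K]].
Proof.
move=> c0 M0 A0 B0.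
have D0 : 0 < 3 / 2 * M + c^-1 + 2.
  by have : 0 < c^-1; [rewrite invr_gt0|lra].
have [r r0 rE] : exists2 r, 0 < r & r = c / 4 / (3 / 2 * M + c^-1 + 2).
  by exists (c / 4 / (3 / 2 * M + c^-1 + 2)); rewrite // !divr_gt0.
have big (e b : R) : 0 < e -> 0 <= b -> exists2 k, 0 <= k & forall K, k <= K -> b <= e * K.
  move=> e0 b0; exists (b / e); first by rewrite divr_ge0// ltW.
  by move=> K; rewrite ler_pdivrMr// mulrC.
have [k1 k10 H1] := big r B r0 B0.
have [k2 k20 H2] := big r 1 r0 ler01.
have [k3 k30 H3] : exists2 k, 0 <= k & forall K, k <= K -> 8 * A * B + 2 * B <= r ^+ 2 * K.
  by apply: big; rewrite ?exprn_gt0// addr_ge0 ?mulr_ge0.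
have [k4 k40 H4] : exists2 k, 0 <= k & forall K, k <= K -> A <= c ^+ 2 / 8 * K.
  by apply: big; rewrite ?divr_gt0 ?exprn_gt0.
have [k5 k50 H5] : exists2 k, 0 <= k & forall K, k <= K ->
    12 * A * (1 + A + B) + 4 * A <= c / 4 * K.
  apply: big; first by rewrite divr_gt0.
  by rewrite addr_ge0// ?mulr_ge0// !addr_ge0.
exists r, (1 + k1 + k2 + k3 + k4 + k5 + 6 * M); split => //; first lra.
  by rewrite rE mulrC divfK// gt_eqF.
split; [apply: H1|apply: H2|apply: H3|apply: H4|split; [|apply: H5]]; lra.
Qed.

End constants.

(** * Smoothness and vanishing of the integrands *)

Section smooth_densities.
Context {R : realType} {d : nat}.
Local Notation E := 'rV[R]_d.
Implicit Types (phi a : E -> R) (x : E).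

Lemma Cinf_density phi a tau lambda : Cinf phi -> Cinf a ->
  Cinf (fun x => expR (tau * phi x) ^+ 2 * (1 + (lambda * a x) ^+ 2)).
Proof.
move=> Cphi Ca; have Cc (c : R) : Cinf (fun _ : E => c) by exact: Cinf_cst.
apply: CinfM; first exact/CinfX/Cinf_weight.
by apply: CinfD => //; apply: CinfX; exact: CinfM.
Qed.

Lemma Cinf_mass phi a tau lambda u1 u2 : Cinf phi -> Cinf a -> Cinf u1 -> Cinf u2 ->
  Cinf (mass phi a tau lambda u1 u2).
Proof.
move=> Cphi Ca C1 C2; apply: CinfM; first exact: Cinf_density.
by apply: CinfD; exact: CinfX.
Qed.

Lemma Cinf_energy phi a tau lambda u1 u2 : Cinf phi -> Cinf a -> Cinf u1 -> Cinf u2 ->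
  Cinf (energy phi a tau lambda u1 u2).
Proof.
move=> Cphi Ca C1 C2; apply: CinfM; first exact: Cinf_density.
by apply: CinfD; exact: Cinf_gdot.
Qed.

Lemma Cinf_source phi a tau lambda u1 u2 : Cinf phi -> Cinf a -> Cinf u1 -> Cinf u2 ->
  Cinf (source phi a tau lambda u1 u2).
Proof.
move=> Cphi Ca C1 C2; have Cc (c : R) : Cinf (fun _ : E => c) by exact: Cinf_cst.
have Cl (f : E -> R) : Cinf f -> Cinf (fun y => - laplacian f y).
  by move=> Cf; apply: CinfN; exact: Cinf_laplacian.
have Cd (f : E -> R) : Cinf f -> Cinf (fun y => lambda * divergence a f y).
  by move=> Cf; apply: CinfM => //; exact: Cinf_divergence.
have Cu (f : E -> R) : Cinf f -> Cinf (fun y => lambda ^+ 2 * f y) by move=> Cf; exact: CinfM.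
apply: CinfM; first exact/CinfX/Cinf_weight.
apply: CinfD; apply: CinfX.
  apply: CinfB (Cu _ C1); exact: CinfD (Cl _ C1) (Cd _ C2).
apply: CinfB (Cu _ C2); exact: CinfB (Cl _ C2) (Cd _ C1).
Qed.

Lemma density_eq0 phi a tau lambda u1 u2 x :
  Cinf a -> Cinf u1 -> Cinf u2 ->
  (\forall y \near x, u1 y = 0) -> (\forall y \near x, u2 y = 0) ->
  [/\ mass phi a tau lambda u1 u2 x = 0, energy phi a tau lambda u1 u2 x = 0 &
      source phi a tau lambda u1 u2 x = 0].
Proof.
move=> Ca C1 C2 /near_partials_eq0[z1 _ l1 g1] /near_partials_eq0[z2 _ l2 g2].
split; rewrite /mass /energy /source.
- by rewrite z1 z2 expr0n addr0 mulr0.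
- by rewrite g1 g2 addr0 mulr0.
- rewrite /divergence z1 z2 l1 l2 g1 g2.
  by rewrite !(mulr0, oppr0, addr0, expr0n).
Qed.

End smooth_densities.

(** * Integration of the pointwise estimate *)

Theorem theorem3p2 (R : realType) (d : nat) (Omega V : set 'rV[R]_d)
    (a phi : 'rV[R]_d -> R)
    (Omega_domain : bounded_domain Omega)
    (Omega_smooth : smooth_boundary Omega)
    (a_test : test_function Omega a)
    (a_ge0 : forall x, 0 <= a x)
    (a_neq0 : exists x, a x != 0)
    (V_open : open V) (V_sub : V `<=` Omega)
    (phi_smooth : smooth phi)
    (phi_sub : sub_elliptic V phi) :
  exists C K lambda0 : R, [/\ 0 < C, 0 < K, 0 < lambda0 &
    forall (u : 'rV[R]_d -> R[i]) (lambda tau : R),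
      ctest_function V u ->
      lambda0 <= lambda ->
      Num.max (K * `|lambda| `^ (5 / 4)) 1 <= tau ->
      let weight x : R :=
        Num.sqrt (1 + lambda ^+ 2 * a x ^+ 2) * expR (tau * phi x) in
      ((tau ^+ 3)%:E * L2norm V (fun x => (weight x)%:C%C * u x)%R ^+ 2
       + tau%:E * L2norm_vec V (fun x => (weight x)%:C%C *: Dgrad u x)%R ^+ 2
       <= C%:E * L2norm V
            (fun x => (expR (tau * phi x))%:C%C * Pop a lambda u x)%R ^+ 2)%E].
Proof.
have Cphi := smooth_Cinf phi_smooth; have [/smooth_Cinf Ca _ _] := a_test.
have cV : compact (closure V).
  by have [_ _ _ bO] := Omega_domain; exact: compact_closure_bounded bO V_sub.
have [mu [c [M [Cmu c0 M0 conv]]]] := convexifier_exists Cphi cV phi_sub.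
have [A A0 HA] := test_function_bounds a_test a_ge0.
have [kappa [Ck kE]] : exists k, Cinf k /\ forall x, 2^-1 * k x = mu x.
  exists (fun y => 2 * mu y); split; first by apply: CinfM => //; exact: Cinf_cst.
  by move=> x; rewrite mulrA mulVf ?mul1r// pnatr_eq0.
have CL := Cinf_laplacian Cphi.
have [b1 b10 Hb1] := compact_bounded_fun cV (Cinf_continuous_in (A := closure V)
  (CinfD (Cinf_gdot CL CL) (Cinf_gdot Ck Ck))).
have [b2 b20 Hb2] := compact_bounded_fun cV (Cinf_continuous_in (A := closure V) (CinfX 2 CL)).
have [b3 b30 Hb3] := compact_bounded_fun cV (Cinf_continuous_in (A := closure V) (CinfX 2 Ck)).
have [b4 b40 Hb4] := compact_bounded_fun cV
  (Cinf_continuous_in (A := closure V) (Cinf_gdot Cphi Cphi)).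
have [B [B0 B1 B2 B3 B4]] : exists B,
    [/\ 0 <= B, 2 * b1 <= B, b2 <= B, b3 <= B & b4 <= B].
  by exists (2 * b1 + b2 + b3 + b4); split; lra.
have [r [K [r0 K1 Hr [BrK rK ABK AK [MK absK]]]]] := constants_exist c0 M0 A0 B0.
have D0 : 0 < (4 + 3 * A + 3 * B) * (4 / c).
  by rewrite mulr_gt0// ?divr_gt0//; lra.
(* The constant of [damped_estimate], doubled by its [2 * source]; all largeness is carried by [K],
   so [lambda0 = 1] will do. *)
exists ((4 + 3 * A + 3 * B) * (4 / c) * 2), K, 1; split => //.
- by rewrite mulr_gt0.
- exact: lt_le_trans K1.
move=> u lambda tau [[su1 su2] cS SV] l1; rewrite ge_max => /andP[Kt t1]; cbv zeta.
have [Kl Kl5] := powR_large K1 l1 Kt.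
pose u1 x := complex.Re (u x); pose u2 x := complex.Im (u x).
have C1 : Cinf u1 := smooth_Cinf su1.
have C2 : Cinf u2 := smooth_Cinf su2.
pose S := closure [set x | u x != 0].
have uS x : ~ S x -> \forall y \near x, u y = 0.
  move=> nSx; have : nbhs x (~` S).
    by apply: open_nbhs_nbhs; split=> //; apply: closed_openC; exact: closed_closure.
  apply: filterS => y uy; apply/eqP/negPn/negP => uy0; apply: uy.
  exact: subset_closure.
have u1S x : ~ S x -> \forall y \near x, u1 y = 0.
  by move=> /uS; apply: filterS => y; rewrite /u1 => ->.
have u2S x : ~ S x -> \forall y \near x, u2 y = 0.
  by move=> /uS; apply: filterS => y; rewrite /u2 => ->.
have nVS x : ~ V x -> ~ S x by move=> nVx /SV.
have near0 x : ~ S x -> [/\ mass phi a tau lambda u1 u2 x = 0,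
    energy phi a tau lambda u1 u2 x = 0 & source phi a tau lambda u1 u2 x = 0].
  by move=> nSx; apply: density_eq0 => //; [exact: u1S|exact: u2S].
have [N HN] := compact_norm_bound cS.
have w2 x : (Num.sqrt (1 + lambda ^+ 2 * a x ^+ 2) * expR (tau * phi x)) ^+ 2 =
    expR (tau * phi x) ^+ 2 * (1 + (lambda * a x) ^+ 2).
  by rewrite exprMn sqr_sqrtr ?exprMn 1?mulrC// addr_ge0// mulr_ge0 ?sqr_ge0.
have normc_eq0 (z : R[i]) : Normc.normc z ^+ 2 = 0 -> Normc.normc z = 0.
  by move=> /eqP; rewrite sqrf_eq0 => /eqP.
have [P1 P2] : (forall x, complex.Re (Pop a lambda u x) =
      - laplacian u1 x + lambda * divergence a u2 x - lambda ^+ 2 * u1 x) /\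
    (forall x, complex.Im (Pop a lambda u x) =
      - laplacian u2 x - lambda * divergence a u1 x - lambda ^+ 2 * u2 x).
  by split=> x; case: (Re_Pop lambda x (conj su1 su2) Ca).
have massE x : Normc.normc ((Num.sqrt (1 + lambda ^+ 2 * a x ^+ 2)
    * expR (tau * phi x))%:C%C * u x) ^+ 2 = mass phi a tau lambda u1 u2 x.
  by rewrite normc_sqr w2.
have energyE x : cenorm ((Num.sqrt (1 + lambda ^+ 2 * a x ^+ 2)
    * expR (tau * phi x))%:C%C *: Dgrad u x) ^+ 2 = energy phi a tau lambda u1 u2 x.
  rewrite cenorm_sqr /energy -w2 /gdot -big_split mulr_sumr.
  apply: eq_bigr => j _; rewrite !mxE normc_sqr DopE /= sqrrN addrC.
  by rewrite -/u1 -/u2 !expr2.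
have sourceE x : Normc.normc ((expR (tau * phi x))%:C%C * Pop a lambda u x) ^+ 2 =
    source phi a tau lambda u1 u2 x.
  by rewrite normc_sqr P1 P2.
rewrite /L2norm /L2norm_vec !L2norm_modulus_sqr; last first.
- by move=> x /nVS/near0[m0 _ _]; apply: normc_eq0; rewrite massE.
- by move=> x /nVS/near0[_ e0 _]; apply/eqP; rewrite -sqrf_eq0 energyE e0.
- by move=> x /nVS/near0[_ _ s0]; apply: normc_eq0; rewrite sourceE.
under eq_integral do rewrite massE.
under [X in (_ + _ * X <= _)%E]eq_integral do rewrite energyE.
under [X in (_ <= _ * X)%E]eq_integral do rewrite sourceE.
have v1 : vanishing N u1 by move=> x /HN/u1S/nbhs_singleton.
have v2 : vanishing N u2 by move=> x /HN/u2S/nbhs_singleton.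
apply: (@integral_smooth_le _ _ _ _ _
    (fun x => - ((4 + 3 * A + 3 * B) * (4 / c))
              * damped_flux phi kappa a tau lambda u1 u2 x) N).
- exact: Cinf_mass.
- exact: Cinf_energy.
- exact: Cinf_source.
- by move=> x /HN/near0[].
- by move=> x /HN/near0[].
- by move=> x /HN/near0[].
- by apply: null_integralZ; exact: (@null_damped_flux _ _ _ _ _ _ _ _ _ N).
(* Off [V] the convexity bounds may fail, but both sides are zero there, the flux included. *)
move=> x; have [Vx|nVx] := pselect (V x); last first.
  have [-> -> ->] := near0 x (nVS x nVx).
  rewrite damped_flux_eq0//; [by rewrite !mulr0 addr0|exact/u1S/nVS|exact/u2S/nVS].
have distr (D s f : R) : D * 2 * s + - D * f = D * (2 * s - f) by ring.
rewrite distr.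
have cVx : closure V x by exact: subset_closure.
have [convx HQ] := conv x cVx.
have [aA lA] := HA x.
have le_b (f : 'rV[R]_d -> R) (b : R) : (forall y, closure V y -> `|f y| <= b) -> f x <= b.
  by move=> fb; exact: le_trans (ler_norm _) (fb x cVx).
apply: (@damped_estimate _ _ c M A B r K) => //.
- by move=> z; rewrite kE; exact: convx.
- by rewrite kE.
- apply: le_trans B1; rewrite ler_pM2l//; exact: le_b _ _ Hb1.
- exact: le_trans (le_b _ _ Hb2) B2.
- exact: le_trans (le_b _ _ Hb3) B3.
- exact: le_trans (le_b _ _ Hb4) B4.
Qed.
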